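(* Let $k$ be a number field, let $N\ge 1$, and let $\Lambda\subset\mathbb{P}^N_k$ be a positive-dimensional $k$-linear subspace. Then for every $c\in\mathrm{Cl}(k)$ the set $\Phi_N^{-1}(c)\cap\Lambda(k)$ satisfies weak approximation on $\Lambda$. That is: for every $c\in\mathrm{Cl}(k)$, every finite set $S$ of places of $k$, and every choice of non-empty open subsets $\mathcal{U}_v\subset\Lambda(k_v)$ for $v\in S$, there exists $P\in\Lambda(k)$ such that $\Phi_N(P)=c$ and $P\in\mathcal{U}_v$ for all $v\in S$.
   Context: $\mathcal{O}_k$ is the ring of integers of $k$ and $\mathrm{Cl}(k)$ is its ideal class group. For $N\ge 1$ the ideal class map is $\Phi_N:\mathbb{P}^N(k)\to\mathrm{Cl}(k)$, $[x_0:\cdots:x_N]\mapsto[x_0\mathcal{O}_k+\cdots+x_N\mathcal{O}_k]$, the class of the fractional ideal generated by the homogeneous coordinates (well defined since scaling changes the ideal by a principal factor). Places of $k$ may be finite or infinite; $k_v$ is the completion of $k$ at $v$, and $\Lambda(k_v)$ carries the $v$-adic topology. A positive-dimensional $k$-linear subspace is $\Lambda=\mathbb{P}(V)$, the space of lines in a $k$-vector subspace $V\subset k^{N+1}$ of dimension at least $2$ (possibly $V=k^{N+1}$). *)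

(* Defs.v *)
From HB Require Import structures.
From mathcomp Require Import all_boot all_order all_algebra all_field ring.
From mathcomp Require Import all_classical all_reals topology.

Set Implicit Arguments.
Unset Strict Implicit.
Unset Printing Implicit Defensive.

Import Order.TTheory GRing.Theory Num.Theory.
Local Open Scope classical_set_scope.
Local Open Scope ring_scope.

(* The quotient T / e, for an equivalence relation e: an element is an        *)
(* equivalence class, seen as a subset of T.                                  *)
Definition class_type (T : Type) (e : T -> T -> Prop) : Type :=
  {C : set T | exists x, C = e x}.

Definition class_of (T : Type) (e : T -> T -> Prop) (x : T) : class_type e :=
  exist _ (e x) (ex_intro _ x erefl).

Lemma class_ofP (T : Type) (e : T -> T -> Prop) (x y : T) :
  (forall u, e u u) -> (forall u v, e u v -> e v u) ->
  (forall u v w, e u v -> e v w -> e u w) ->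
  class_of e x = class_of e y <-> e x y.
Proof.
move=> er es et; split.
  by move=> /(congr1 (fun C => sval C y)) /= ->; exact: er.
move=> exy; apply: eq_exist => /=; apply/seteqP; split=> z /= h.
  exact: et (es _ _ exy) h.
exact: et exy h.
Qed.

Section ProjectiveSpace.
Variables (F : fieldType) (N : nat).

Record projective_space := ProjPoint {
  proj_line :> {vspace 'rV[F]_N.+1};
  dim_proj_line : \dim proj_line == 1%N }.

HB.instance Definition _ := [isSub for proj_line].
HB.instance Definition _ := [Choice of projective_space by <:].

Definition linear_subspace (V : {vspace 'rV[F]_N.+1}) : set projective_space :=
  [set P | (P <= V)%VS].

(* A choice of homogeneous coordinates. *)
Definition hcoord (P : projective_space) : 'rV[F]_N.+1 := vpick P.

Lemma hcoord_neq0 P : hcoord P != 0.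
Proof. by rewrite vpick0 -dimv_eq0 (eqP (dim_proj_line P)). Qed.

Lemma hcoord_scale (P : projective_space) x : x \in P -> x != 0 ->
  exists2 c : F, c != 0 & x = c *: hcoord P.
Proof.
move=> xP x0; have /eqP vP : <[hcoord P]>%VS == P.
  by rewrite eqEdim -memvE memv_pick /= dim_vline hcoord_neq0 (eqP (dim_proj_line P)).
move: xP; rewrite -vP => /vlineP[c xE]; exists c => //.
by apply: contraNneq x0 => c0; rewrite xE c0 scale0r.
Qed.

End ProjectiveSpace.

Section BaseChange.
Variables (F K : fieldType) (iota : {rmorphism F -> K}) (N : nat).

(* The image of V \otimes_F K in K^(N+1). *)
Definition base_change (V : {vspace 'rV[F]_N.+1}) : {vspace 'rV[K]_N.+1} :=
  <<[seq map_mx iota x | x <- vbasis V]>>%VS.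

Lemma mem_base_change (V : {vspace 'rV[F]_N.+1}) (x : 'rV[F]_N.+1) : x \in V -> map_mx iota x \in base_change V.
Proof.
move=> /coord_vbasis ->; rewrite raddf_sum /=; apply: memv_suml => i _.
rewrite map_mxZ; apply/memvZ/memv_span/map_f.
by rewrite mem_nth // size_tuple.
Qed.

Lemma dim_base_change_line (L : {vspace 'rV[F]_N.+1}) :
  \dim L == 1%N -> \dim (base_change L) == 1%N.
Proof.
move=> L1; set x := vpick L.
have x0 : x != 0 by rewrite vpick0 -dimv_eq0 (eqP L1).
have xE : <[x]>%VS = L.
  by apply/eqP; rewrite eqEdim -memvE memv_pick /= dim_vline x0 (eqP L1).
suff -> : base_change L = <[map_mx iota x]>%VS.
  by rewrite dim_vline map_mx_eq0 x0.
apply/eqP; rewrite eqEsubv -memvE mem_base_change ?memv_pick // andbT.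
apply/span_subvP => _ /mapP[y /vbasis_mem + ->].
by rewrite -xE => /vlineP[c ->]; rewrite map_mxZ memvZ ?memv_line.
Qed.

Definition proj_map (P : projective_space F N) : projective_space K N :=
  ProjPoint (dim_base_change_line (dim_proj_line P)).

End BaseChange.

Section AbsoluteValue.
Variable R : realType.

Record absolute_value (F : fieldType) := AbsoluteValue {
  absv :> F -> R;
  absv_ge0 : forall x, 0 <= absv x;
  absv_eq0 : forall x, absv x = 0 <-> x = 0;
  absvM : forall x y, absv (x * y) = absv x * absv y;
  absv_triangle : forall x y, absv (x + y) <= absv x + absv y }.

(* F with the metric |y - x|. *)
Definition valued (F : fieldType) (a : absolute_value F) : Type := F.

Section ValuedMetric.
Variables (F : fieldType) (a : absolute_value F).

Let dist (x y : F) : R := a (y - x).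

Lemma absv0 : a 0 = 0. Proof. exact/absv_eq0. Qed.

Lemma absv1 : a 1 = 1.
Proof.
have a10 : a 1 != 0 by apply/eqP => /absv_eq0/eqP; rewrite oner_eq0.
by apply: (mulfI a10); rewrite -absvM !mulr1.
Qed.

Lemma absvN x : a (- x) = a x.
Proof.
suff aN1 : a (- 1) = 1 by rewrite -mulN1r absvM aN1 mul1r.
have /eqP : a (- 1) ^+ 2 = 1 by rewrite expr2 -absvM mulrNN mulr1 absv1.
rewrite sqrf_eq1 => /orP[/eqP //|/eqP h].
by have := absv_ge0 a (- 1); rewrite h ler0N1.
Qed.

Let distxx x : dist x x = 0.
Proof. by rewrite /dist subrr absv0. Qed.

Let dist_positivity x y : dist x y = 0 -> x = y.
Proof. by move=> /absv_eq0/eqP; rewrite subr_eq0 => /eqP. Qed.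

Let dist_sym x y : dist x y = dist y x.
Proof. by rewrite /dist -absvN opprB. Qed.

Let dist_triangle y x z : dist x z <= dist x y + dist y z.
Proof. by rewrite addrC /dist -{1}(subrK y z) -addrA; exact: absv_triangle. Qed.

HB.instance Definition _ := Choice.copy (valued a) F.
HB.instance Definition _ := isPointed.Build (valued a) (0 : F).
HB.instance Definition _ :=
  isMetric.Build R (valued a) distxx dist_positivity dist_sym dist_triangle.

End ValuedMetric.

Definition absv_nontrivial (F : fieldType) (a : absolute_value F) : Prop :=
  exists2 x, x != 0 & a x != 1.

(* Two absolute values are equivalent when they define the same topology. *)
Definition absv_equiv (F : fieldType) (a b : absolute_value F) : Prop :=
  forall U : set F, open (U : set (valued a)) <-> open (U : set (valued b)).

Section Restriction.
Variables (F K : fieldType) (iota : {rmorphism F -> K}) (a : absolute_value K).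

Let res (x : F) : R := a (iota x).

Let res_eq0 x : res x = 0 <-> x = 0.
Proof.
split=> [/absv_eq0/eqP|->]; first by rewrite fmorph_eq0 => /eqP.
by rewrite /res rmorph0 absv0.
Qed.

Let resM x y : res (x * y) = res x * res y.
Proof. by rewrite /res rmorphM absvM. Qed.

Let res_triangle x y : res (x + y) <= res x + res y.
Proof. by rewrite /res rmorphD absv_triangle. Qed.

Definition absv_restrict : absolute_value F :=
  AbsoluteValue (fun x => absv_ge0 a (iota x)) res_eq0 resM res_triangle.

End Restriction.

(* Equivalence classes of nontrivial absolute values, both finite (i.e.       *)
(* nonarchimedean) and infinite (i.e. archimedean).                           *)
Definition place (F : fieldType) : Type :=
  {v : class_type (@absv_equiv F) |
    forall a, sval v a -> absv_nontrivial a}.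

Definition place_of (F : fieldType) (v : place F) : set (absolute_value F) :=
  sval (sval v).

(* A completion of F at v: it is unique up to a unique isomorphism of         *)
(* topological fields over F. Its absolute value is determined by v only up   *)
(* to equivalence, so its topology is determined by v.                        *)
Record completion (F : fieldType) (v : place F) := Completion {
  compl_field :> fieldType;
  compl_absv : absolute_value compl_field;
  compl_emb : {rmorphism F -> compl_field};
  compl_place : place_of v (absv_restrict compl_emb compl_absv);
  compl_dense : dense (range compl_emb : set (valued compl_absv));
  compl_complete : forall G : set_system (valued compl_absv),
    ProperFilter G -> cauchy G -> cvg G }.

Section ProjectiveTopology.
Variables (K : fieldType) (a : absolute_value K) (N : nat).

(* The quotient topology of P^N(K) = (K^(N+1) \ 0) / K^*. *)
Definition projective_open (W : set (projective_space K N)) : Prop :=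
  open ([set x | x != 0 /\ exists2 P, W P & x \in P]
          : set 'rV[valued a]_N.+1).

Definition open_in_subspace (V : {vspace 'rV[K]_N.+1})
    (U : set (projective_space K N)) : Prop :=
  exists2 W, projective_open W & U = W `&` linear_subspace V.

End ProjectiveTopology.

End AbsoluteValue.

Section IdealClasses.
Variable k : fieldExtType rat.

Definition ring_of_integers : set k := [set x | integralOver (intr : int -> k) x].

Local Notation OK := ring_of_integers.

Lemma ring_of_integers0 : OK 0. Proof. exact: integral0. Qed.

Lemma ring_of_integers1 : OK 1. Proof. exact: integral1. Qed.

Lemma ring_of_integersD x y : OK x -> OK y -> OK (x + y).
Proof. exact: integral_add. Qed.

Lemma ring_of_integersM x y : OK x -> OK y -> OK (x * y).
Proof. exact: integral_mul. Qed.

Record fractional_ideal := FractionalIdeal {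
  frac_set :> set k;
  frac0 : frac_set 0;
  fracD : forall x y, frac_set x -> frac_set y -> frac_set (x + y);
  fracM : forall r x, OK r -> frac_set x -> frac_set (r * x);
  frac_neq0 : exists2 x, frac_set x & x != 0;
  frac_denom : exists d, [/\ OK d, d != 0 & forall x, frac_set x -> OK (d * x)]
}.

Definition ideal_equiv (I J : fractional_ideal) : Prop :=
  exists2 a : k, a != 0 & J = [set a * x | x in I] :> set k.

Definition class_group : Type := class_type ideal_equiv.

Definition ideal_class (I : fractional_ideal) : class_group :=
  class_of ideal_equiv I.

Lemma ideal_equiv_refl I : ideal_equiv I I.
Proof.
exists 1; first exact: oner_neq0.
apply/seteqP; split=> [x Ix|_ [x Ix <-]]; last by rewrite mul1r.
by exists x => //; rewrite mul1r.
Qed.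

Lemma ideal_equiv_sym I J : ideal_equiv I J -> ideal_equiv J I.
Proof.
move=> [a a0 JE]; exists a^-1; rewrite ?invr_eq0 // JE.
apply/seteqP; split=> [x Ix|_ [_ [x Ix <-] <-]]; last by rewrite mulKf.
by exists (a * x); [exists x|rewrite mulKf].
Qed.

Lemma ideal_equiv_trans I J L :
  ideal_equiv I J -> ideal_equiv J L -> ideal_equiv I L.
Proof.
move=> [a a0 JE] [b b0 LE]; exists (b * a); first by rewrite mulf_neq0.
rewrite LE JE; apply/seteqP; split=> [_ [_ [x Ix <-] <-]|_ [x Ix <-]].
  by exists x => //; rewrite mulrA.
by exists (a * x); [exists x|rewrite mulrA].
Qed.

Lemma ideal_classP I J : ideal_class I = ideal_class J <-> ideal_equiv I J.
Proof.
exact: class_ofP ideal_equiv_refl ideal_equiv_sym ideal_equiv_trans.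
Qed.

Lemma integral_denom (x : k) :
  exists d, [/\ OK d, d != 0 & OK (d * x)].
Proof.
have [p mp px] := alg_integral x.
have [q [a a0 pE]] := rat_poly_scale p.
pose Q := map_poly (intr : int -> k) q; have qx : root Q x.
  have c0 : (a%:~R^-1 : rat)%:A != 0 :> k.
    by rewrite scaler_eq0 oner_eq0 orbF invr_eq0 intr_eq0.
  move: px; rewrite pE map_polyZ /= (rootZ _ _ c0).
  rewrite -map_poly_comp; congr (root _ x); apply: eq_map_poly => z /=.
  by rewrite scaler_int.
have intr_inj : injective (intr : int -> k).
  move=> u v /eqP; rewrite -subr_eq0 -rmorphB /= -(@scaler_int rat) scaler_eq0.
  by rewrite oner_eq0 orbF intr_eq0 subr_eq0 => /eqP.
have q0 : q != 0.
  apply: contraTneq (monic_neq0 mp) => q0.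
  by rewrite pE q0 rmorph0 scaler0 eqxx.
have sQ : size Q = size q by rewrite size_map_inj_poly ?rmorph0.
have Q0 : Q != 0 by rewrite -size_poly_gt0 sQ size_poly_gt0.
have := root_size_gt1 Q0 qx; case sQm : (size Q) => [//|[//|m]] _.
pose l := lead_coef Q; have l0 : l != 0 by rewrite lead_coef_eq0.
have lO i : OK Q`_i by rewrite coef_map; exact: integral_id.
exists l; split => //; first exact: lO.
pose S := \poly_(i < m.+1) (Q`_i * l ^+ (m - i)).
have S_lt : (size S < size ('X^(m.+1) : {poly k}))%N.
  by rewrite size_polyXn ltnS size_poly.
apply: (@integral_root_monic _ _ _ _ ('X^(m.+1) + S)).
- by rewrite monicE lead_coefDl // lead_coefXn.
- apply/rootP; rewrite hornerD hornerXn horner_poly.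
  have qxE : l ^+ m * Q.[x] = 0 by rewrite (rootP qx) mulr0.
  rewrite -[RHS]qxE horner_coef sQm [in RHS]big_ord_recr /= mulrDr addrC.
  congr (_ + _); last first.
    have -> : Q`_m.+1 = l by rewrite /l lead_coefE sQm.
    by rewrite exprMn exprS; ring.
  rewrite mulr_sumr; apply: eq_bigr => i _.
  have -> : l ^+ m = l ^+ (m - i) * l ^+ i by rewrite -exprD subnK // -ltnS.
  by rewrite exprMn; ring.
- apply/integral_poly => i; rewrite coefD coefXn coef_poly.
  apply: integral_add; first exact: integral_nat.
  case: ifP => _; last exact: integral0.
  apply: integral_mul; first exact: lO.
  elim: (m - i)%N => [|j IH]; first exact: integral1.
  by rewrite exprS; apply: integral_mul => //; exact: lO.
Qed.

Section CoordinateIdeal.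
Variables (n : nat) (x : 'rV[k]_n).

Definition coord_set : set k :=
  [set y | exists2 r : 'I_n -> k,
     (forall i, OK (r i)) & y = \sum_i r i * x 0 i].

Hypothesis x0 : x != 0.

Let coord0 : coord_set 0.
Proof.
exists (fun=> 0) => [i|]; first exact: ring_of_integers0.
by rewrite big1 // => i _; rewrite mul0r.
Qed.

Let coordD y z : coord_set y -> coord_set z -> coord_set (y + z).
Proof.
move=> [r rO ->] [s sO ->]; exists (fun i => r i + s i) => [i|].
  exact: ring_of_integersD.
by rewrite -big_split; apply: eq_bigr => i _; rewrite mulrDl.
Qed.

Let coordM r y : OK r -> coord_set y -> coord_set (r * y).
Proof.
move=> rO [s sO ->]; exists (fun i => r * s i) => [i|].
  exact: ring_of_integersM.
by rewrite mulr_sumr; apply: eq_bigr => i _; rewrite mulrA.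
Qed.

Let coord_neq0 : exists2 y, coord_set y & y != 0.
Proof.
have /rV0Pn[i xi0] := x0; exists (x 0 i) => //.
exists (fun j => (j == i)%:R) => [j|]; first exact: integral_nat.
rewrite (bigD1 i) //= eqxx mul1r big1 ?addr0 // => j /negPf ->.
by rewrite mul0r.
Qed.

Let coord_denom :
  exists d, [/\ OK d, d != 0 & forall y, coord_set y -> OK (d * y)].
Proof.
have /choice[d dP] := fun i => integral_denom (x 0 i).
have prodO (P : pred 'I_n) : OK (\prod_(i | P i) d i).
  apply: (big_ind (fun z => OK z)) => [|u v|i _].
  - exact: ring_of_integers1.
  - exact: ring_of_integersM.
  - by have [] := dP i.
exists (\prod_i d i); split; first exact: prodO.
  by apply/prodf_neq0 => i _; have [] := dP i.
move=> _ [r rO ->]; rewrite mulr_sumr.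
apply: (big_ind (fun z => OK z)) => [|u v|i _].
- exact: ring_of_integers0.
- exact: ring_of_integersD.
rewrite mulrCA (bigD1 i) //= mulrAC; apply: ring_of_integersM => //.
by apply: ring_of_integersM; [have [] := dP i|exact: prodO].
Qed.

Definition coord_ideal : fractional_ideal :=
  FractionalIdeal coord0 coordD coordM coord_neq0 coord_denom.

End CoordinateIdeal.

Variable N : nat.

Definition ideal_class_map (P : projective_space k N) : class_group :=
  ideal_class (coord_ideal (hcoord_neq0 P)).

(* The class does not depend on the choice of the homogeneous coordinates. *)
Lemma ideal_class_mapE (P : projective_space k N) (x : 'rV[k]_N.+1)
    (x0 : x != 0) : x \in P ->
  ideal_class_map P = ideal_class (coord_ideal x0).
Proof.
move=> xP; apply/ideal_classP.
have [c c0 xE] := hcoord_scale xP x0; exists c => //=.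
have cE r : \sum_i r i * x 0 i = c * \sum_i r i * hcoord P 0 i.
  by rewrite mulr_sumr; apply: eq_bigr => i _; rewrite xE mxE mulrCA.
apply/seteqP; split=> [_ [r rO ->]|_ [_ [r rO ->] <-]].
  by exists (\sum_i r i * hcoord P 0 i); [exists r|rewrite cE].
by exists r.
Qed.

End IdealClasses.

(* Main.v *)
Require Import Defs.
From HB Require Import structures.
From mathcomp Require Import all_boot all_order all_algebra all_field.
From mathcomp Require Import all_classical all_reals topology.
From mathcomp Require Import ring lra zify.

(** Weak approximation on the linear space provides a vector x of V close to the
target at every place of S; the point then has to be moved slightly so that its
ideal class becomes c. After scaling, let y be a second vector of V such that x
and y have integral coordinates and some 2 x 2 minor M of (x, y) is nonzero. The
point al x + be y is close to x at v as soon as be / al is small at v, and its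
coordinates can be controlled: if al is congruent to 1 modulo a multiple n of M
and n divides be, then they generate the product of the ideals (al, be) and
I = (x_0, ..., x_N). Indeed, away from the primes dividing M the pair (x, y)
extends to a basis of the lattice of integral vectors; at those primes al is a
unit, and the ideal of al x + be y contains M, hence the coordinates of be y,
hence those of x.
It remains to choose (al, be) in the class of C I^-1, where C is an ideal of
class c, and this is possible: every ideal class contains an integral ideal
prime to n, and that ideal has generators of this form
([congruent_generators], [coord_ideal_pencil]).

Why be / al can also be made small at the places of S: at a finite place it is
enough that n be divisible by a high power of an integer that is small there,
since al is then close to 1. The ideal (al, be) and the congruences are not
affected when al is replaced by al + 2^g be, and be / (al + 2^g be) tends to 0 at
every infinite place when g grows. So the prescribed class costs nothing at
infinity.

The arithmetic rests on two properties of a fractional ideal A: A / n A is cyclic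
for n nonzero ([gen_moduloP]), whence A has two generators, and A is invertible
([frac_invertible]). Neither uses the factorization into prime ideals. A primitive
integer relation between the powers of xi yields the inverse of the ideal (1, xi)
([prufer_identity]); idempotents modulo n then merge two generators into one
([gen_modulo_merge]); and the dimension of k over the rationals bounds the
length of the chains of ideals between p A and A that this produces
([gen_modulo_prime]).

On the side of places, a nontrivial absolute value either has |2| > 1 or is at
most 1 on all integral elements ([absv_integral_le1]), which separates infinite
from finite places; and inequivalent absolute values are independent by the
argument of Artin and Whaples ([weak_approximation]). *)

Set Implicit Arguments.
Unset Strict Implicit.
Unset Printing Implicit Defensive.

Import Order.TTheory GRing.Theory Num.Theory.
Local Open Scope classical_set_scope.
Local Open Scope ring_scope.

(** * Integral elements of a number field *)

(** The combination is a gcd of the family, so that a family of integers can be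
divided by its content. *)
Lemma int_bezout_seq (n : nat) (f : nat -> int) :
  exists mu : nat -> int,
    forall i, (i < n)%N -> (\sum_(j < n) mu j * f j %| f i)%Z.
Proof.
elim: n => [|n [mu IH]]; first by exists (fun=> 0).
set g := \sum_(j < n) _ in IH.
have [u [v uvE]] := Bezoutz g (f n).
exists (fun j => if (j < n)%N then u * mu j else v) => i.
rewrite big_ord_recr /= ltnn.
have -> : \sum_(j < n) (if (j < n)%N then u * mu j else v) * f j = u * g.
  by rewrite mulr_sumr; apply: eq_bigr => j _; rewrite ltn_ord mulrA.
rewrite uvE ltnS leq_eqVlt => /orP[/eqP ->|/IH]; first exact: dvdz_gcdr.
by apply: dvdz_trans; exact: dvdz_gcdl.
Qed.

(** Clearing denominators and dividing by the gcd makes the family primitive; the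
Bezout coefficients mu are the form in which primitivity gets used. *)
Lemma rat_primitive (n : nat) (c : nat -> rat) :
  (exists2 i, (i < n)%N & c i != 0) ->
  exists (m mu : nat -> int) (l : rat),
    (forall i, (i < n)%N -> (m i)%:~R = l * c i) /\
    \sum_(i < n) mu i * m i = 1.
Proof.
move=> [i0 i0n ci0].
pose D := \prod_(i < n) denq (c i).
have D0 : D != 0 by apply/prodf_neq0 => i _; exact: denq_neq0.
have fP i : exists f : int, (i < n)%N -> f%:~R = D%:~R * c i.
  have [iltn|_] := boolP (i < n)%N; last by exists 0.
  exists (numq (c i) * \prod_(j < n | j != Ordinal iltn) denq (c j)) => _.
  rewrite /D [in RHS](bigD1 (Ordinal iltn)) //= !intrM numqE; ring.
have [f fE] := choice fP.
have [mu muP] := int_bezout_seq n f; set g := \sum_(j < n) _ in muP.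
have g0 : g != 0.
  apply/eqP => g0; have := muP _ i0n; rewrite g0 dvd0z => /eqP fi0.
  have /esym/eqP := fE _ i0n; rewrite fi0 mulf_eq0 intr_eq0 (negPf D0).
  by rewrite (negPf ci0).
have mE i : (i < n)%N -> f i = (f i %/ g)%Z * g.
  by move=> /muP gf; rewrite divzK.
exists (fun i => (f i %/ g)%Z), mu, (D%:~R / g%:~R); split=> [i iltn|].
  apply: (@mulIf _ (g%:~R : rat)); first by rewrite intr_eq0.
  rewrite -intrM -mE // fE // -[RHS]mulrA [c i * _]mulrC mulrA.
  by rewrite divfK ?intr_eq0.
apply: (mulIf g0); rewrite mul1r mulr_suml; apply: eq_bigr => i _.
by rewrite -mulrA -mE.
Qed.

Section IntegerRing.
Variable k : fieldExtType rat.
Local Notation OK := (@ring_of_integers k).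

Lemma ring_of_integersN (x : k) : OK x -> OK (- x).
Proof. exact: integral_opp. Qed.

Lemma ring_of_integersB (x y : k) : OK x -> OK y -> OK (x - y).
Proof. exact: integral_sub. Qed.

Lemma ring_of_integers_int (z : int) : OK z%:~R.
Proof. exact: integral_id. Qed.

Lemma ring_of_integers_nat (m : nat) : OK m%:R.
Proof. exact: integral_nat. Qed.

Lemma ring_of_integersX (x : k) m : OK x -> OK (x ^+ m).
Proof.
move=> xO; elim: m => [|m IH]; first exact: ring_of_integers1.
by rewrite exprS; exact: ring_of_integersM.
Qed.

Lemma ring_of_integers_sum (I : Type) (r : seq I) (P : pred I) (F : I -> k) :
  (forall i, P i -> OK (F i)) -> OK (\sum_(i <- r | P i) F i).
Proof.
move=> FO; apply: (big_ind (fun z => OK z)) => //.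
  exact: ring_of_integers0.
exact: ring_of_integersD.
Qed.

Lemma natr_neq0 (m : nat) : (0 < m)%N -> m%:R != 0 :> k.
Proof.
move=> m0; have -> : m%:R = (m%:R : rat)%:A :> k by rewrite scaler_nat.
by rewrite scaler_eq0 oner_eq0 orbF pnatr_eq0 -lt0n.
Qed.

(** Since the relation is primitive, it survives reduction modulo any prime
number. This bounds the dimension of A / p A for a fractional ideal A without an
integral basis. *)
Lemma int_relation (x : nat -> k) :
  exists m mu : nat -> int,
    \sum_(i < (\dim {:k}).+1) (m i)%:~R * x i = 0 /\
    \sum_(i < (\dim {:k}).+1) mu i * m i = 1.
Proof.
set D := (\dim {:k}).+1.
have nfree : ~~ free [tuple x i | i < D].
  apply/negP => /eqP fX; have := dimvS (subvf <<[tuple x i | i < D]>>).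
  by rewrite fX size_tuple ltnn.
have [c cE [i0 ci0]] : exists2 c : 'I_D -> rat,
    \sum_(i < D) c i *: x i = 0 & exists i, c i != 0.
  apply: contrapT => /forall2NP noc; move/negP: nfree; apply; apply/freeP.
  move=> c cE i; case: (noc c) => [|h].
    case; apply: etrans cE; apply: eq_bigr => j _.
    by rewrite -tnth_nth tnth_mktuple.
  by apply/eqP/contraT => ci; case: h; exists i.
pose c' (i : nat) := if insub i is Some j then c j else 0.
have c'E (i : 'I_D) : c' i = c i by rewrite /c' valK.
have [|m [mu [l [mE muE]]]] := @rat_primitive D c'.
  by exists i0; rewrite ?ltn_ord // c'E.
exists m, mu; split=> //.
have := congr1 ( *:%R l) cE; rewrite scaler0 scaler_sumr.
move=> /(etrans _); apply; apply: eq_bigr => i _.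
rewrite scalerA -c'E -mE ?ltn_ord // scaler_int.
by rewrite mulrzl.
Qed.

(** Multiplied by c ^+ m, the equation becomes monic in c * x. *)
Lemma lead_coefM_integral (c x : k) (m : nat) (a : nat -> k) :
  OK c -> (forall i, OK (a i)) ->
  c * x ^+ m.+1 = \sum_(i < m.+1) a i * x ^+ i -> OK (c * x).
Proof.
move=> cO aO xE.
pose S := \poly_(i < m.+1) (a i * c ^+ (m - i)).
have S_lt : (size (- S) < size ('X^(m.+1) : {poly k}))%N.
  by rewrite size_polyN size_polyXn ltnS size_poly.
apply: (@integral_root_monic _ _ _ _ ('X^(m.+1) - S)).
- by rewrite monicE lead_coefDl // lead_coefXn.
- apply/rootP; rewrite hornerD hornerN hornerXn horner_poly.
  rewrite exprMn exprSr -mulrA xE mulr_sumr; apply/eqP; rewrite subr_eq0.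
  apply/eqP/eq_bigr => i _.
  have -> : c ^+ m = c ^+ (m - i) * c ^+ i by rewrite -exprD subnK // -ltnS.
  by rewrite exprMn; ring.
- apply/integral_poly => i; rewrite coefB coefXn coef_poly.
  apply: ring_of_integersB; first exact: ring_of_integers_nat.
  case: ifP => _; last exact: integral0.
  by apply: ring_of_integersM => //; exact: ring_of_integersX.
Qed.

(** In other words (p, q) is the inverse of the ideal (1, xi). For a primitive
relation m_0 xi^d + ... + m_d = 0, every Horner partial sum h t is the leading
coefficient of an equation of xi with integral coefficients, so that h t and
h t * xi are integral. Since h t.+1 - xi * h t = m_t, the primitivity of m writes
1 as an integer combination of the h t and of the xi * h t. *)
Lemma prufer_identity (xi : k) :
  exists p q : k, [/\ OK p, OK q, OK (p * xi), OK (q * xi) & p + q * xi = 1].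
Proof.
set d := \dim {:k}.
have [m [mu [mE muE]]] := int_relation (fun i => xi ^+ (d - i)).
rewrite -/d in mE muE.
clearbody d.
have [h [h0 hS]] : exists h : nat -> k,
    h 0%N = 0 /\ forall t, h t.+1 = xi * h t + (m t)%:~R.
  by exists (fix h t := if t is t'.+1 then xi * h t' + (m t')%:~R else 0).
have hE t : (t <= d.+1)%N ->
    h t * xi ^+ (d.+1 - t) =
      - \sum_(i < d.+1 | (t <= i)%N) (m i)%:~R * xi ^+ (d - i).
  elim: t => [|t IH] tD; first by rewrite h0 mul0r mE oppr0.
  apply/eqP; rewrite -subr_eq0 opprK.
  have := IH (ltnW tD); rewrite (bigD1 (Ordinal tD)) //= => /eqP.
  rewrite -subr_eq0 opprK => /eqP hE; apply/eqP; apply: (etrans _ hE).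
  rewrite subSS subSn // exprS addrA; congr (_ + _); first by rewrite hS; ring.
  apply: eq_bigl => i; rewrite ltn_neqAle andbC; congr (_ && _).
  by rewrite -val_eqE eq_sym.
have hO t : (t <= d.+1)%N -> OK (h t) /\ OK (h t * xi).
  elim: t => [|t IH] tD.
    by split; rewrite h0 ?mul0r; exact: ring_of_integers0.
  have [_ hxO] := IH (ltnW tD).
  have hO : OK (h t.+1).
    rewrite hS mulrC; apply: ring_of_integersD => //.
    exact: ring_of_integers_int.
  split=> //; have := tD; rewrite ltnS leq_eqVlt => /orP[/eqP tE|td].
    have := hE _ tD; rewrite big_pred0 => [|i]; last first.
      by rewrite tE leqNgt ltn_ord.
    rewrite tE subnn expr0 mulr1 oppr0 => ->; rewrite mul0r.
    exact: ring_of_integers0.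
  have eD : (d - t = (d - t.+1).+1)%N by rewrite -subSn // subSS.
  apply: (@lead_coefM_integral _ _ (d - t.+1) (fun i => - (m (d - i)%N)%:~R)) => //.
    by move=> i; apply/ring_of_integersN/ring_of_integers_int.
  rewrite -eD; have := hE _ tD; rewrite subSS => ->.
  rewrite -sumrN [LHS](reindex_inj rev_ord_inj) /=.
  rewrite (big_ord_widen_cond d.+1 xpredT
             (fun i => - (m (d - i)%N)%:~R * xi ^+ i)); last by lia.
  apply: eq_big => [i|i _] /=; first by have := ltn_ord i; lia.
  by rewrite subSS subKn ?mulNr // -ltnS.
exists (\sum_(t < d.+1) (mu t)%:~R * h t.+1).
exists (- \sum_(t < d.+1) (mu t)%:~R * h t).
split.
- apply: ring_of_integers_sum => t _; apply: ring_of_integersM.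
    exact: ring_of_integers_int.
  exact: (hO _ (ltn_ord t)).1.
- apply/ring_of_integersN/ring_of_integers_sum => t _; apply: ring_of_integersM.
    exact: ring_of_integers_int.
  exact: (hO _ (ltnW (ltn_ord t))).1.
- rewrite mulr_suml; apply: ring_of_integers_sum => t _; rewrite -mulrA.
  apply: ring_of_integersM; first exact: ring_of_integers_int.
  exact: (hO _ (ltn_ord t)).2.
- rewrite mulNr mulr_suml; apply/ring_of_integersN/ring_of_integers_sum => t _.
  rewrite -mulrA.
  apply: ring_of_integersM; first exact: ring_of_integers_int.
  exact: (hO _ (ltnW (ltn_ord t))).2.
- rewrite mulNr mulr_suml -sumrB.
  apply: etrans (congr1 (intr : int -> k) muE); rewrite rmorph_sum /=.
  apply: eq_bigr => t _.
  by rewrite intrM hS; ring.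
Qed.

(** All powers of an integral element lie in one finitely generated group: this
is the source of periodicity modulo n and of boundedness under an absolute value
that is at most 1 on the integers. *)
Lemma powers_span (r : k) : OK r ->
  exists D, forall l, exists z : nat -> int,
    r ^+ l = \sum_(i < D) (z i)%:~R * r ^+ i.
Proof.
move=> [f mf /rootP fr]; exists (size f).-1 => l.
exists (fun i => (Pdiv.Ring.rmodp 'X^l f)`_i).
have sR : (size (map_poly intr (Pdiv.Ring.rmodp 'X^l f) : {poly k})
             <= (size f).-1)%N.
  apply: leq_trans (size_poly _ _) _; rewrite -ltnS prednK; last first.
    by rewrite lt0n size_poly_eq0 monic_neq0.
  by rewrite Pdiv.Ring.ltn_rmodpN0 // monic_neq0.
have := congr1 (fun p => (map_poly intr p).[r])
  (Pdiv.RingMonic.rdivp_eq mf 'X^l).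
rewrite rmorphD rmorphM /= hornerD hornerM fr mulr0 add0r.
rewrite map_polyXn hornerXn => ->.
rewrite (horner_coef_wide _ sR); apply: eq_bigr => i _; rewrite coef_map //.
Qed.

(** Modulo n the powers of r take finitely many values, hence are eventually
periodic; the exponent N is a multiple of the period beyond the preperiod. *)
Lemma idempotent_power (r : k) (n : nat) : OK r -> (0 < n)%N ->
  exists2 N, (0 < N)%N & exists2 s, OK s & r ^+ N ^+ 2 = r ^+ N + n%:R * s.
Proof.
move=> rO n0; have [D /choice[z zE]] := powers_span rO.
have modlt l i : (`|(z l i %% n)%Z| < n)%N.
  by rewrite -ltz_nat gez0_abs ?modz_ge0 ?ltz_pmod //; lia.
pose F (l : nat) : {ffun 'I_D -> 'I_n} := [ffun i : 'I_D => Ordinal (modlt l i)].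
pose T := {ffun 'I_D -> 'I_n}.
have /injectivePn[i [j ij Fij]] : ~~ injectiveb (fun l : 'I_#|T|.+1 => F l).
  by apply/injectiveP => /leq_card; rewrite card_ord ltnn.
have {i j ij Fij} [i [t Fit]] : exists i t, F i = F (i + t.+1)%N.
  wlog: i j ij Fij / (i < j)%N.
    move: ij; rewrite -val_eqE neq_ltn => /orP[] h /(_ _ _ _ _ h); apply=> //.
      by rewrite -val_eqE neq_ltn h.
    by rewrite -val_eqE neq_ltn h.
  move=> lij; exists i, (j - i).-1; rewrite [F (i : nat)]Fij; congr F; lia.
have per l : (i <= l)%N ->
    exists2 s, OK s & r ^+ (l + t.+1) = r ^+ l + n%:R * s.
  move=> il.
  exists (r ^+ (l - i) *
    \sum_(a < D) (((z (i + t.+1)%N a - z i a) %/ n)%Z)%:~R * r ^+ a).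
    apply: ring_of_integersM; first exact: ring_of_integersX.
    apply: ring_of_integers_sum => a _; apply: ring_of_integersM.
      exact: ring_of_integers_int.
    exact: ring_of_integersX.
  have eil : (l = l - i + i)%N by rewrite subnK.
  rewrite {1 2}eil -addnA !exprD -exprD mulrCA -mulrDr; congr (_ * _).
  rewrite [X in X = _]zE [X in _ = X + _]zE mulr_sumr -big_split.
  apply: eq_bigr => a _ /=.
  rewrite mulrA -mulrDl; congr (_ * _).
  have dvd : (n %| z (i + t.+1)%N a - z i a)%Z.
    rewrite -eqz_mod_dvd; apply/eqP.
    move/ffunP/(_ a): Fit; rewrite !ffunE => /(congr1 val) /= /(congr1 Posz).
    by rewrite !gez0_abs ?modz_ge0 // -?lt0n.
  have : z (i + t.+1)%N a = z i a + n%:Z * ((z (i + t.+1)%N a - z i a) %/ n)%Z.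
    by rewrite [n%:Z * _]mulrC divzK // addrC subrK.
  by move=> /(congr1 (intr : int -> k)); rewrite intrD intrM.
have pers l s : (i <= l)%N ->
    exists2 u, OK u & r ^+ (l + s * t.+1) = r ^+ l + n%:R * u.
  move=> il; elim: s => [|s [u uO uE]].
    by exists 0; [exact: ring_of_integers0|rewrite mul0n addn0 mulr0 addr0].
  have [w wO wE] := per (l + s * t.+1)%N (leq_trans il (leq_addr _ _)).
  exists (u + w); first exact: ring_of_integersD.
  by rewrite mulSn [(t.+1 + _)%N]addnC addnA wE uE mulrDr addrA.
exists (i.+1 * t.+1)%N; first by rewrite muln_gt0.
have [|u uO uE] := @pers (i.+1 * t.+1)%N i.+1; first by nia.
by exists u => //; rewrite -exprM muln2 -addnn uE.
Qed.

(** Up to sign, m is the lowest nonzero coefficient of an integral equation of r. *)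
Lemma integral_dvd_nat (r : k) : OK r -> r != 0 ->
  exists2 m : nat, (0 < m)%N & exists2 s, OK s & m%:R = r * s.
Proof.
move=> rO r0.
suff [z z0 [s sO zE]] : exists2 z : int, z != 0 &
    exists2 s, OK s & z%:~R = r * s.
  exists `|z|%N; first by rewrite absz_gt0.
  have [za|za] := leP 0 z.
    exists s => //; rewrite -zE -[in RHS](gez0_abs za) //.
  exists (- s); first exact: ring_of_integersN.
  by rewrite mulrN -zE -intrN -ltz0_abs.
have [f mf /rootP fr] := rO; have := monic_neq0 mf; move: fr; clear mf.
elim/poly_ind: f => [|f a IH]; first by rewrite eqxx.
have [a0|a0 fr _] := eqVneq a 0.
  rewrite a0 polyC0 addr0 rmorphM /= hornerM map_polyX hornerX => /eqP.
  rewrite mulf_eq0 (negPf r0) orbF => /eqP fr fX0; apply: IH => //.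
  by apply: contraNneq fX0 => ->; rewrite mul0r.
exists a => //; exists (- (map_poly intr f).[r]).
  apply: ring_of_integersN; rewrite horner_coef; apply: ring_of_integers_sum => i _.
  apply: ring_of_integersM; last exact: ring_of_integersX.
  by rewrite coef_map; exact: ring_of_integers_int.
move: fr; rewrite rmorphD rmorphM /= map_polyX map_polyC /= !hornerE => /eqP.
by rewrite addr_eq0 => /eqP rE; rewrite mulrN mulrC rE opprK.
Qed.

End IntegerRing.

(** * Fractional ideals *)

Local Identity Coercion set_to_fun : set >-> Funclass.

Section FractionalIdeals.
Variable k : fieldExtType rat.
Local Notation OK := (@ring_of_integers k).
Implicit Types A B I J : fractional_ideal k.

Lemma fracN A x : A x -> A (- x).
Proof.
move=> Ax; rewrite -mulN1r; apply: fracM => //.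
exact/ring_of_integersN/ring_of_integers1.
Qed.

Lemma fracB A x y : A x -> A y -> A (x - y).
Proof. by move=> Ax Ay; apply: fracD => //; exact: fracN. Qed.

Lemma frac_sum A (T : Type) (r : seq T) (P : pred T) (F : T -> k) :
  (forall i, P i -> A (F i)) -> A (\sum_(i <- r | P i) F i).
Proof.
move=> FA; apply: (big_ind (fun z => A z)) => //; first exact: frac0.
exact: fracD.
Qed.

Definition gen_modulo A (n a x : k) : Prop :=
  exists r y, [/\ OK r, A y & x = r * a + n * y].

Section GenModulo.
Variables (A : fractional_ideal k) (n : k).

Lemma gen_modulo_refl a : gen_modulo A n a a.
Proof.
exists 1, 0; split; [exact: ring_of_integers1|exact: frac0|].
by rewrite mul1r mulr0 addr0.
Qed.

Lemma gen_modulo0 a y : A y -> gen_modulo A n a (n * y).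
Proof.
by exists 0, y; split; [exact: ring_of_integers0| |rewrite mul0r add0r].
Qed.

Lemma gen_moduloD a x y : gen_modulo A n a x -> gen_modulo A n a y ->
  gen_modulo A n a (x + y).
Proof.
move=> [r [u [rO uA ->]]] [s [v [sO vA ->]]]; exists (r + s), (u + v).
split; [exact: ring_of_integersD|exact: fracD|by ring].
Qed.

Lemma gen_moduloM a r x : OK r -> gen_modulo A n a x -> gen_modulo A n a (r * x).
Proof.
move=> rO [s [v [sO vA ->]]]; exists (r * s), (r * v).
split; [exact: ring_of_integersM|exact: fracM|by ring].
Qed.

Lemma gen_modulo_trans a b x :
  gen_modulo A n a b -> gen_modulo A n b x -> gen_modulo A n a x.
Proof.
move=> ab [s [v [sO vA ->]]].
by apply: gen_moduloD; [exact: gen_moduloM|exact: gen_modulo0].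
Qed.

End GenModulo.

(** With p + q * (b / a) = 1 as in [prufer_identity], p * (b / a) is integral, so
a generates the ideal (a, b) where p is invertible; and b generates it where
1 - p = q * (b / a) is invertible. An idempotent e modulo n that is a power of p
separates the two regions, and c = e * a + (1 - e) * b generates on both. *)
Lemma gen_modulo_merge A (n : nat) (a b : k) : (0 < n)%N -> A a -> A b ->
  exists c, [/\ A c, gen_modulo A n%:R c a & gen_modulo A n%:R c b].
Proof.
move=> n0 Aa Ab; have [a0|a0] := eqVneq a 0.
  exists b; split=> //; last exact: gen_modulo_refl.
  by rewrite a0 -(mulr0 n%:R); apply: gen_modulo0; exact: frac0.
have [p [q [pO qO pxO qxO pq1]]] := prufer_identity (b / a).
have [N N0 [s sO]] := idempotent_power pO n0.
set e := p ^+ N; rewrite expr2 => eE.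
have eO : OK e by exact: ring_of_integersX.
have e'O : OK (1 - e) by apply: ring_of_integersB => //; exact: ring_of_integers1.
pose c := e * a + (1 - e) * b.
have ea : e * a = e * c - n%:R * (s * (a - b)).
  have -> : e * c = (e * e) * a + (e - e * e) * b by rewrite /c; ring.
  by rewrite eE; ring.
have eb : (1 - e) * b = (1 - e) * c + n%:R * (s * (a - b)).
  have -> : (1 - e) * c = (e - e * e) * a + (1 - 2 * e + e * e) * b.
    by rewrite /c; ring.
  by rewrite eE; ring.
have gea : gen_modulo A n%:R c (e * a).
  exists e, (- (s * (a - b))); split=> //; last by rewrite mulrN.
  by apply/fracN/fracM => //; exact: fracB.
have geb : gen_modulo A n%:R c ((1 - e) * b).
  exists (1 - e), (s * (a - b)); split=> //.
  by apply/fracM => //; exact: fracB.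
exists c; split.
- by apply: fracD; exact: fracM.
- pose G := \sum_(i < N) p ^+ i.
  have aE : (1 - e) * a = q * G * b.
    rewrite /e -[X in X - _](expr1n _ N) subrXX /G.
    under eq_bigr do rewrite expr1n mul1r.
    have -> : 1 - p = q * (b / a) by apply/eqP; rewrite subr_eq addrC pq1.
    have : b / a * a = b by rewrite divfK.
    set z := b / a => <-; ring.
  have -> : a = e * a + (q * G * ((1 - e) * b) - n%:R * (s * a)).
    have -> : q * G * ((1 - e) * b) = (1 - 2 * e + e * e) * a.
      by rewrite mulrCA -aE; ring.
    by rewrite eE; ring.
  apply: gen_moduloD => //; apply: gen_moduloD.
    apply: gen_moduloM => //; apply: ring_of_integersM => //.
    by apply: ring_of_integers_sum => i _; exact: ring_of_integersX.
  by rewrite -mulrN; apply/gen_modulo0/fracN/fracM.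
- pose u := p ^+ N.-1 * (p * (b / a)).
  have uO : OK u by apply: ring_of_integersM => //; exact: ring_of_integersX.
  have eub : e * b = u * a.
    rewrite /u /e -[in LHS](prednK N0) exprSr.
    have : b / a * a = b by rewrite divfK.
    set z := b / a => <-; ring.
  have -> : b = u * (e * a) + ((1 - e) * b - n%:R * (s * b)).
    have -> : u * (e * a) = (e * e) * b by rewrite -mulrA eub; ring.
    by rewrite eE; ring.
  apply: gen_moduloD; first exact: gen_moduloM.
  apply: gen_moduloD => //.
  by rewrite -mulrN; apply/gen_modulo0/fracN/fracM.
Qed.

(** If no element of A works, [gen_modulo_merge] gives an infinite chain
c_0 O + p A < c_1 O + p A < ..., where x_i lies in the module of c_(i+1) but not
in the module of c_i. In a primitive relation between x_0, ..., x_d, with d the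
dimension of k, the last x_i whose coefficient is prime to p then belongs to
c_i O + p A, a contradiction. *)
Lemma gen_modulo_prime A (p : nat) : prime p ->
  exists2 a, A a & forall x, A x -> gen_modulo A p%:R a x.
Proof.
move=> pp; apply: contrapT => none.
have /choice[f fP] c : exists x, A c -> A x /\ ~ gen_modulo A p%:R c x.
  have [Ac|nAc] := pselect (A c); last by exists 0.
  have [x [Ax xc]] : exists x, A x /\ ~ gen_modulo A p%:R c x.
    apply: contrapT => h; apply: none; exists c => // x Ax.
    by apply: contrapT => xc; apply: h; exists x.
  by exists x.
have /choice[g gP] c : exists d, A c ->
    [/\ A d, gen_modulo A p%:R d c & gen_modulo A p%:R d (f c)].
  have [Ac|nAc] := pselect (A c); last by exists 0.
  have [d dP] := gen_modulo_merge (prime_gt0 pp) Ac (fP _ Ac).1.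
  by exists d.
pose c i := iter i g 0.
have cA i : A (c i).
  by elim: i => [|i /gP[]] //; exact: frac0.
pose x i := f (c i).
have xA i : A (x i) by have [] := fP _ (cA i).
have mono i j : gen_modulo A p%:R (c (j + i)%N) (c i).
  elim: j => [|j IH]; first exact: gen_modulo_refl.
  by rewrite addSn; apply: gen_modulo_trans IH; have [] := gP _ (cA (j + i)%N).
have xM j i : (j < i)%N -> gen_modulo A p%:R (c i) (x j).
  move=> ji; rewrite -(subnK ji); apply: gen_modulo_trans (mono _ _) _.
  by have [] := gP _ (cA j).
have [m [mu []]] := int_relation x.
set D := (\dim _).+1 => mE muE.
have exm : exists i : nat, (i < D)%N && ~~ (p %| m i)%Z.
  apply: contrapT => h; have : (p %| \sum_(i < D) mu i * m i)%Z.
    apply: rpred_sum => i _; apply: dvdz_mull; apply/contraT => pm.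
    by case: h; exists i; rewrite ltn_ord.
  by rewrite muE dvdzE dvdn1 absz_nat => /eqP p1; move: pp; rewrite p1.
have bnd i : (i < D)%N && ~~ (p %| m i)%Z -> (i <= D)%N by case/andP => /ltnW.
have [i /andP[iD pmi] imax] := ex_maxnP exm bnd.
have [_] := fP _ (cA i); apply; rewrite -/(x i).
have [u [v uv]] := Bezoutz (m i) p.
have uv1 : u * m i + v * p = 1.
  rewrite uv /gcdz; have : coprime p `|m i| by rewrite prime_coprime // -dvdzE.
  by rewrite coprime_sym /coprime => /eqP ->.
have -> : x i = u%:~R * ((m i)%:~R * x i) + p%:R * (v%:~R * x i).
  have := congr1 (intr : int -> k) uv1; rewrite intrD !intrM => uvk.
  by rewrite -[LHS]mul1r -[X in X * _]uvk; ring.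
apply: gen_moduloD; last first.
  by apply: gen_modulo0; apply: fracM => //; exact: ring_of_integers_int.
apply: gen_moduloM; first exact: ring_of_integers_int.
have -> : (m i)%:~R * x i = - \sum_(j < D | j != Ordinal iD) (m j)%:~R * x j.
  by apply/eqP; rewrite -addr_eq0; move: mE; rewrite (bigD1 (Ordinal iD)) //= => ->.
rewrite -sumrN; apply: (big_ind (fun z => gen_modulo A p%:R (c i) z)).
- by rewrite -(mulr0 p%:R); apply: gen_modulo0; exact: frac0.
- by move=> *; exact: gen_moduloD.
move=> j; rewrite -val_eqE /= neq_ltn => /orP[ji|ij].
  rewrite -mulNr; apply: gen_moduloM; last exact: xM.
  by apply/ring_of_integersN/ring_of_integers_int.
have [pmj|pmj] := boolP (p %| m j)%Z; last first.
  by have := imax j; rewrite ltn_ord pmj leqNgt ij => /(_ isT).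
have -> : - ((m j)%:~R * x j) = p%:R * ((- (m j %/ p)%Z)%:~R * x j).
  rewrite -{1}(divzK pmj) intrM intrN; ring.
by apply/gen_modulo0/fracM => //; exact: ring_of_integers_int.
Qed.

(** If A = a O + p A and A = b O + m A, then A = a O + p b O + p m A, and a merges
with p b. *)
Lemma gen_modulo_nat A (n : nat) : (0 < n)%N ->
  exists2 a, A a & forall x, A x -> gen_modulo A n%:R a x.
Proof.
elim/ltn_ind: n => n IH n0; have [n1|n1] := leqP n 1.
  exists 0; first exact: frac0.
  have -> : n = 1%N by lia.
  by move=> x Ax; rewrite -[x]mul1r; exact: gen_modulo0.
have pp := pdiv_prime n1; set p := pdiv n in pp.
have nE : n = (p * (n %/ p))%N by rewrite mulnC divnK // pdiv_dvd.
set m := (n %/ p)%N in nE.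
have m0 : (0 < m)%N by move: n0; rewrite nE muln_gt0 => /andP[].
have [b Ab bP] : exists2 a, A a & forall x, A x -> gen_modulo A m%:R a x.
  by apply: IH => //; rewrite nE ltn_Pmull // prime_gt1.
have [a Aa aP] := gen_modulo_prime A pp.
have [|c [Ac ca cb]] := gen_modulo_merge n0 Aa (_ : A (p%:R * b)).
  by apply: fracM => //; exact: ring_of_integers_nat.
exists c => // x /aP[r [y [rO /bP[s [z [sO zA ->]]] ->]]].
rewrite mulrDr addrA [p%:R * (m%:R * z)]mulrA -natrM -nE [p%:R * _]mulrCA.
apply: gen_moduloD; last exact: gen_modulo0.
by apply: gen_moduloD; exact: gen_moduloM.
Qed.

(** This is what the Chinese remainder theorem gives in a Dedekind ring, where an
ideal is principal modulo n. *)
Lemma gen_moduloP A (n : k) : OK n -> n != 0 ->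
  exists2 a, A a & forall x, A x -> gen_modulo A n a x.
Proof.
move=> nO n0; have [m m0 [s sO mE]] := integral_dvd_nat nO n0.
have [a Aa aP] := gen_modulo_nat A m0; exists a => // x /aP[r [y [rO yA ->]]].
by exists r, (s * y); split=> //; [exact: fracM|rewrite mE mulrA].
Qed.

Section Colon.
Variables B A : fractional_ideal k.

Definition colon_set : set k := [set z | forall x, A x -> B (z * x)].

Let colon0 : colon_set 0.
Proof. by move=> x _; rewrite mul0r; exact: frac0. Qed.

Let colonD x y : colon_set x -> colon_set y -> colon_set (x + y).
Proof.
by move=> xC yC z Az; rewrite mulrDl; apply: fracD; [exact: xC|exact: yC].
Qed.

Let colonM r x : OK r -> colon_set x -> colon_set (r * x).
Proof. by move=> rO xC z Az; rewrite -mulrA; apply: fracM => //; exact: xC. Qed.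

Let colon_neq0 : exists2 x, colon_set x & x != 0.
Proof.
have [d [dO d0 dA]] := frac_denom A; have [b Bb b0] := frac_neq0 B.
exists (d * b); last exact: mulf_neq0.
by move=> x Ax; rewrite mulrAC; apply: fracM => //; exact: dA.
Qed.

Let colon_denom : exists d, [/\ OK d, d != 0 & forall x, colon_set x -> OK (d * x)].
Proof.
have [d [dO d0 dA]] := frac_denom A; have [a Aa a0] := frac_neq0 A.
have [e [eO e0 eB]] := frac_denom B.
exists (e * (d * a)); split; first by apply: ring_of_integersM => //; exact: dA.
  by rewrite !mulf_neq0.
move=> x xC; have -> : e * (d * a) * x = d * (e * (x * a)) by ring.
by apply: ring_of_integersM => //; apply: eB; exact: xC.
Qed.

Definition colon_ideal : fractional_ideal k :=
  FractionalIdeal colon0 colonD colonM colon_neq0 colon_denom.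

End Colon.

Lemma unit_ideal_denom : exists d, [/\ OK d, d != 0 & forall x, OK x -> OK (d * x)].
Proof.
exists 1; split; [exact: ring_of_integers1|exact: oner_neq0|].
by move=> x; rewrite mul1r.
Qed.

Lemma unit_ideal_neq0 : exists2 x, OK x & x != 0.
Proof. by exists 1; [exact: ring_of_integers1|exact: oner_neq0]. Qed.

Definition unit_ideal : fractional_ideal k :=
  FractionalIdeal (@ring_of_integers0 k) (@ring_of_integersD k)
    (@ring_of_integersM k) unit_ideal_neq0 unit_ideal_denom.

(** If d A is integral, then n = d * a satisfies n A < a O, so a generator of A
modulo n completes a. *)
Lemma two_generators A (a : k) : A a -> a != 0 ->
  exists2 b, A b &
    forall x, A x -> exists r s, [/\ OK r, OK s & x = r * a + s * b].
Proof.
move=> Aa a0; have [d [dO d0 dA]] := frac_denom A.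
have [|b Ab bP] := gen_moduloP A (dA _ Aa); first exact: mulf_neq0.
exists b => // x /bP[r [y [rO Ay ->]]].
exists (d * y), r; split=> //; first exact: dA.
by ring.
Qed.

(** By two generators A = a (1, b / a), and [prufer_identity] inverts (1, b / a). *)
Lemma frac_invertible A : exists u v s t,
  [/\ A u, A v, colon_ideal unit_ideal A s, colon_ideal unit_ideal A t
    & u * s + v * t = 1].
Proof.
have [a Aa a0] := frac_neq0 A; have [b Ab bP] := two_generators Aa a0.
have [p [q [pO qO pxO qxO pq1]]] := prufer_identity (b / a).
exists a, b, (p / a), (q / a); split=> //.
- move=> _ /bP[r [s [rO sO ->]]] /=.
  have -> : p / a * (r * a + s * b) = r * p * (a / a) + s * (p * (b / a)) by ring.
  by rewrite divff // mulr1; apply: ring_of_integersD; exact: ring_of_integersM.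
- move=> _ /bP[r [s [rO sO ->]]] /=.
  have -> : q / a * (r * a + s * b) = r * q * (a / a) + s * (q * (b / a)) by ring.
  by rewrite divff // mulr1; apply: ring_of_integersD; exact: ring_of_integersM.
have -> : a * (p / a) + b * (q / a) = p * (a / a) + q * (b / a) by ring.
by rewrite divff // mulr1.
Qed.

(** Let a generate J^-1 modulo n. Then a J is an integral ideal prime to n, so it
contains some a * j congruent to 1 modulo n. A second generator a * b of a J may be
multiplied by n: as n is invertible modulo a * j, this generates the same ideal. *)
Lemma congruent_generators J (n : k) : OK n -> n != 0 ->
  exists a j b t : k,
    [/\ J j, J b, OK t & a * j = 1 + n * t] /\
    [/\ a != 0, (forall x, J x -> OK (a * x)) &
    forall x, J x -> exists r s, [/\ OK r, OK s &
      a * x = r * (a * j) + s * (n * (a * b))]].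
Proof.
move=> nO n0.
have [a [j [t [aT Jj tO aj0 ajE]]]] : exists a j t,
    [/\ colon_ideal unit_ideal J a, J j, OK t, a * j != 0 & a * j = 1 + n * t].
  have [u [v [s [t [Ju Jv sT tT st1]]]]] := frac_invertible J.
  have [a aT aP] := gen_moduloP (colon_ideal unit_ideal J) nO n0.
  have [r [y [rO yT sE]]] := aP _ sT; have [r' [y' [rO' yT' tE]]] := aP _ tT.
  pose j := u * r + v * r'; pose w := u * y + v * y'.
  have Jj : J j by apply: fracD; rewrite mulrC; exact: fracM.
  have wO : OK w by apply: ring_of_integersD; rewrite mulrC; [exact: yT|exact: yT'].
  have ajE : a * j = 1 - n * w by rewrite -st1 sE tE /j /w; ring.
  have [aj0|] := eqVneq (a * j) 0; last first.
    exists a, j, (- w); split=> //; first exact: ring_of_integersN.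
    by rewrite ajE mulrN.
  have nw : n * w = 1 by apply/eqP; rewrite -subr_eq0 -oppr_eq0 opprB -ajE aj0.
  have [a1 a1T a10] := frac_neq0 (colon_ideal unit_ideal J).
  have [j1 Jj1 j10] := frac_neq0 J.
  exists a1, j1, (w * (a1 * j1 - 1)); split=> //.
  - apply: ring_of_integersM => //; apply: ring_of_integersB.
      exact: a1T.
    exact: ring_of_integers1.
  - exact: mulf_neq0.
  - by rewrite mulrA nw; ring.
have [b Jb bP] := gen_moduloP J (aT _ Jj) aj0.
exists a, j, b, t; split; split=> //.
  by move: aj0; rewrite mulf_eq0 => /norP[].
move=> x /bP[r [y [rO Jy ->]]].
exists (a * y + r * (a * b)), (- t * r); split.
- by apply: ring_of_integersD; [exact: aT|apply: ring_of_integersM => //; exact: aT].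
- by apply: ring_of_integersM => //; exact: ring_of_integersN.
have -> : - t * r * (n * (a * b)) = - (n * t) * (r * (a * b)) by ring.
have -> : n * t = a * j - 1 by rewrite ajE addrC addKr.
by ring.
Qed.

Lemma coord_set_coord (m : nat) (x : 'rV[k]_m) i : coord_set x (x 0 i).
Proof.
exists (fun j => (j == i)%:R) => [j|]; first exact: ring_of_integers_nat.
rewrite (bigD1 i) //= eqxx mul1r big1 ?addr0 // => j /negPf ->.
by rewrite mul0r.
Qed.

(** Here I is the ideal of x, J = (C : I), and al = a + h * (n * b), be = n * b
generate l J; the claim is that w = al *: x + be *: y has ideal
(al, be) I = l J I = l C. Let D be the minor. Eliminating y or x from w shows that
the ideal of w contains D (al, be); since n is a multiple of D, it then contains
be *: x and be *: y, hence al *: x. The parameter h is free because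
(al + h be, be) = (al, be). *)
Lemma coord_ideal_pencil (m : nat) (x y : 'rV[k]_m) (i0 j0 : 'I_m) (n n' : k)
    (C : fractional_ideal k) :
  (forall i, OK (x 0 i)) -> (forall i, OK (y 0 i)) ->
  x 0 i0 * y 0 j0 - x 0 j0 * y 0 i0 != 0 ->
  OK n' -> n = n' * (x 0 i0 * y 0 j0 - x 0 j0 * y 0 i0) -> n != 0 ->
  exists a b t : k, [/\ OK t, a = 1 + n * t & OK b] /\
    exists2 l : k, l != 0 & forall h, OK h ->
      coord_set ((a + h * (n * b)) *: x + (n * b) *: y) = [set l * z | z in C].
Proof.
move=> xO yO D0 n'O nE n0; set D := _ - _ in D0 nE.
have DO : OK D by apply: ring_of_integersB; exact: ring_of_integersM.
have nO : OK n by rewrite nE; exact: ring_of_integersM.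
have x0 : x != 0.
  by apply: contraNneq D0 => x0; rewrite /D x0 !mxE !mul0r subrr.
pose I := coord_ideal x0; pose J := colon_ideal C I.
have xI i : I (x 0 i) by exact: coord_set_coord.
have DI : I D.
  by apply: fracB; rewrite mulrC; exact: fracM.
have [l [j [b [t [[Jj Jb tO ljE] [l0 lJ JP]]]]]] :=
  congruent_generators J nO n0.
have lbO : OK (l * b) by exact: lJ.
exists (l * j), (l * b), t; split=> //; exists l => // h hO.
set al := l * j + _; set be := n * _.
have beO : OK be by exact: ring_of_integersM.
pose w := al *: x + be *: y; rewrite -/w.
have wE i : w 0 i = al * x 0 i + be * y 0 i by rewrite !mxE.
apply/seteqP; split.
  move=> _ [r rO ->].
  suff /choice[z /all_and2[zC wz]] : forall i, exists z, C z /\ w 0 i = l * z.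
    exists (\sum_i r i * z i); first by apply: frac_sum => i _; exact: fracM.
    by rewrite mulr_sumr; apply: eq_bigr => i _; rewrite wz mulrCA.
  move=> i; exists ((j + h * n * b) * x 0 i + n' * y 0 i * (b * D)).
  split; last by rewrite wE /al /be nE; ring.
  apply: fracD; last first.
    by apply: fracM; [exact: ring_of_integersM|exact: Jb].
  rewrite mulrDl -[h * n * b * _]mulrA; apply: fracD; first exact: Jj.
  by apply: fracM; [exact: ring_of_integersM|exact: Jb].
have w0D : w 0 i0 * y 0 j0 - w 0 j0 * y 0 i0 = al * D by rewrite !wE /D; ring.
have w1D : w 0 j0 * x 0 i0 - w 0 i0 * x 0 j0 = be * D by rewrite !wE /D; ring.
have CW0 : coord_set w 0.
  exists (fun=> 0) => [i|]; first exact: ring_of_integers0.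
  by rewrite big1 // => i _; rewrite mul0r.
have CWD u v : coord_set w u -> coord_set w v -> coord_set w (u + v).
  move=> [r rO ->] [s sO ->]; exists (fun i => r i + s i) => [i|].
    exact: ring_of_integersD.
  by rewrite -big_split; apply: eq_bigr => i _; rewrite mulrDl.
have CWM r u : OK r -> coord_set w u -> coord_set w (r * u).
  move=> rO [s sO ->]; exists (fun i => r * s i) => [i|].
    exact: ring_of_integersM.
  by rewrite mulr_sumr; apply: eq_bigr => i _; rewrite mulrA.
have CWw i : coord_set w (w 0 i) by exact: coord_set_coord.
have CWalD : coord_set w (al * D).
  rewrite -w0D -mulrN mulrC; apply: CWD; first exact: CWM.
  by rewrite mulrC; apply: CWM => //; exact: ring_of_integersN.
have CWbeD : coord_set w (be * D).
  rewrite -w1D -mulrN mulrC; apply: CWD; first exact: CWM.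
  by rewrite mulrC; apply: CWM => //; exact: ring_of_integersN.
have CWlb : coord_set w (l * b * D).
  have -> : l * b * D = l * b * (al * D) - (l * b * h + t) * (be * D).
    rewrite /al ljE /be; ring.
  rewrite -mulNr; apply: CWD; apply: CWM => //.
  by apply/ring_of_integersN/ring_of_integersD => //; exact: ring_of_integersM.
have CWbe z : OK z -> coord_set w (be * z).
  move=> zO; have -> : be * z = n' * z * (l * b * D) by rewrite /be nE; ring.
  by apply: CWM => //; exact: ring_of_integersM.
have CWal i : coord_set w (al * x 0 i).
  have -> : al * x 0 i = w 0 i + -1 * (be * y 0 i) by rewrite wE; ring.
  apply: CWD => //; apply: CWM; last exact: CWbe.
  exact/ring_of_integersN/ring_of_integers1.
have CWJ z i : J z -> coord_set w (l * z * x 0 i).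
  move=> /JP[r [s [rO sO ->]]].
  have -> : (r * (l * j) + s * (n * (l * b))) * x 0 i =
    r * (al * x 0 i) + (s - r * h) * (be * x 0 i) by rewrite /al /be; ring.
  apply: CWD; apply: CWM => //; last exact: CWbe.
  by apply: ring_of_integersB => //; exact: ring_of_integersM.
have CWJI z u : J z -> I u -> coord_set w (l * z * u).
  move=> Jz [r rO ->]; rewrite mulr_sumr.
  apply: (big_ind (fun z => coord_set w z)) => // i _.
  by rewrite mulrCA; apply: CWM => //; exact: CWJ.
have [u [v [p [q [Iu Iv pI qI pq1]]]]] := frac_invertible I.
have CJ z p' : C z -> colon_ideal unit_ideal I p' -> J (p' * z).
  move=> Cz p'I /= e Ie; rewrite mulrAC; apply: fracM => //; exact: p'I.
move=> _ [z Cz <-].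
have -> : l * z = l * (p * z) * u + l * (q * z) * v.
  by rewrite -[in LHS](mulr1 z) -pq1; ring.
by apply: CWD; apply: CWJI => //; exact: CJ.
Qed.

End FractionalIdeals.

(** * Absolute values *)

Section RealGrowth.
Variable R : realType.

Lemma bernoulli (d : R) l : 0 <= d -> 1 + l%:R * d <= (1 + d) ^+ l.
Proof.
move=> d0; elim: l => [|l IH]; first by rewrite mul0r addr0 expr0.
rewrite exprS -natr1; apply: (@le_trans _ _ ((1 + d) * (1 + l%:R * d)));
  last by rewrite ler_wpM2l ?addr_ge0.
have : 0 <= l%:R * (d * d) by apply: mulr_ge0 => //; exact: mulr_ge0.
lra.
Qed.

Lemma natr_unbounded (x : R) : exists2 L, (0 < L)%N & x < L%:R.
Proof.
exists (Num.bound `|x|).+1 => //.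
apply: le_lt_trans (ler_norm x) _.
apply: lt_trans (archi_boundP (normr_ge0 x)) _.
by rewrite ltr_nat.
Qed.

Lemma expr_unbounded (t M : R) : 1 < t -> \forall l \near \oo, M < t ^+ l.
Proof.
move=> t1; have d0 : 0 < t - 1 by rewrite subr_gt0.
have [L L0 LM] := natr_unbounded (M / (t - 1)).
exists L => // l /= Ll.
have := bernoulli l (ltW d0); rewrite [1 + (t - 1)]addrC subrK; apply: lt_le_trans.
rewrite ltr_pdivrMr // in LM.
have : (L%:R * (t - 1) <= l%:R * (t - 1)) by rewrite ler_pM2r // ler_nat.
lra.
Qed.

Lemma expr_small (t e : R) : 0 <= t -> t < 1 -> 0 < e ->
  \forall l \near \oo, t ^+ l < e.
Proof.
move=> t0 t1 e0; have [->|tn0] := eqVneq t 0.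
  by exists 1%N => // l /= l1; rewrite expr0n; case: l l1.
have tp : 0 < t by rewrite lt_neqAle eq_sym tn0.
have : 1 < t^-1 by rewrite invf_gt1.
move=> /(expr_unbounded e^-1) [L _ LP]; exists L => // l /LP /=.
by rewrite exprVn ltf_pV2 ?posrE // exprn_gt0.
Qed.

Lemma expr_bounded_le1 (t B : R) : (forall l, t ^+ l <= B) -> t <= 1.
Proof.
move=> tB; rewrite leNgt; apply/negP => /(expr_unbounded B)[L _ /(_ L (leqnn L)) /=].
by rewrite ltNge tB.
Qed.

(** By Bernoulli's inequality t ^+ (2 * l) grows at least like l ^+ 2 if 1 < t. *)
Lemma expr_linear_le1 (t c : R) :
  (forall l, (0 < l)%N -> t ^+ l <= c * l%:R) -> t <= 1.
Proof.
move=> tc; rewrite leNgt; apply/negP => t1.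
have d0 : 0 < t - 1 by rewrite subr_gt0.
have [L L0 LM] := natr_unbounded (2 * c / (t - 1) ^+ 2).
rewrite ltr_pdivrMr ?exprn_gt0 // in LM.
have := bernoulli L (ltW d0); rewrite [1 + (t - 1)]addrC subrK => tL.
have LR : 1 <= L%:R :> R by rewrite ler1n.
have := tc (L * 2)%N; rewrite muln_gt0 L0 exprM natrM => /(_ isT) tcL.
have : (1 + L%:R * (t - 1)) ^+ 2 <= (t ^+ L) ^+ 2.
  by rewrite ler_sqr ?nnegrE // ?addr_ge0 ?mulr_ge0 ?exprn_ge0 //; lra.
move: LM tcL; set s := t - 1 in d0 *; set u := (t ^+ L) ^+ 2; rewrite !expr2.
nra.
Qed.

Lemma seq_lower_bound (I : eqType) (r : seq I) (e : I -> R) :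
  (forall i, i \in r -> 0 < e i) ->
  exists2 d, 0 < d & forall i, i \in r -> d <= e i.
Proof.
elim: r => [|i r IH] e0; first by exists 1.
have [j jr|d d0 dP] := IH; first by apply: e0; rewrite inE jr orbT.
exists (Num.min d (e i)).
  by rewrite lt_min d0 e0 // mem_head.
move=> j; rewrite inE ge_min => /orP[/eqP ->|/dP ->] //.
by rewrite lexx orbT.
Qed.

Lemma seq_upper_bound (I : eqType) (r : seq I) (f : I -> R) :
  exists2 M, 0 < M & forall i, i \in r -> f i <= M.
Proof.
elim: r => [|i r [M M0 MP]]; first by exists 1.
exists (Num.max M (f i)); first by rewrite lt_max M0.
move=> j; rewrite inE le_max => /orP[/eqP ->|/MP ->] //.
by rewrite lexx orbT.
Qed.

Lemma seq_near (I : eqType) (r : seq I) (P : I -> nat -> Prop) :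
  (forall i, i \in r -> \forall l \near \oo, P i l) ->
  \forall l \near \oo, forall i, i \in r -> P i l.
Proof.
elim: r => [|i r IH] rP; first by near=> l.
have h1 := rP i (mem_head i r).
have h2 : \forall l \near \oo, forall i, i \in r -> P i l.
  by apply: IH => j jr; apply: rP; rewrite inE jr orbT.
near=> l => j; rewrite inE => /orP[/eqP ->|]; first by near: l.
by move: j; near: l.
Unshelve. all: by end_near. Qed.

End RealGrowth.

Section AbsoluteValues.
Variable R : realType.

Section Basics.
Variables (F : fieldType) (a : absolute_value R F).

Lemma absvX x l : a (x ^+ l) = a x ^+ l.
Proof.
elim: l => [|l IH]; first by rewrite !expr0 absv1.
by rewrite !exprS absvM IH.
Qed.

Lemma absv_neq0 x : x != 0 -> a x != 0.
Proof. by apply: contra_neq => /absv_eq0. Qed.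

Lemma absv_gt0 x : x != 0 -> 0 < a x.
Proof. by move=> x0; rewrite lt_neqAle eq_sym absv_neq0 //= absv_ge0. Qed.

Lemma absvV x : a x^-1 = (a x)^-1.
Proof.
have [->|x0] := eqVneq x 0; first by rewrite invr0 absv0 invr0.
apply: (mulfI (absv_neq0 x0)); rewrite -absvM !divff ?absv1 //.
exact: absv_neq0.
Qed.

Lemma absv_div x y : a (x / y) = a x / a y.
Proof. by rewrite absvM absvV. Qed.

Lemma absv_lower x y : a x - a y <= a (x + y).
Proof.
rewrite lerBlDr -[X in a X <= _](addrK y); apply: le_trans (absv_triangle _ _ _) _.
by rewrite absvN.
Qed.

Lemma absv_sum_le (I : Type) (r : seq I) (P : pred I) (f : I -> F) :
  a (\sum_(i <- r | P i) f i) <= \sum_(i <- r | P i) a (f i).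
Proof.
apply: (big_ind2 (fun x (y : R) => a x <= y)) => //; first by rewrite absv0.
by move=> x1 x2 y1 y2 h1 h2; apply: le_trans (absv_triangle _ _ _) (lerD h1 h2).
Qed.

(** An integer below 2 ^ L has L binary digits, so its absolute value is at most L;
for the powers of m this bound is linear in the exponent. *)
Lemma absv_le1_nat : a 2%:R <= 1 -> forall m : nat, a m%:R <= 1.
Proof.
move=> a2 m.
have digits L : forall m, (m < 2 ^ L)%N -> a m%:R <= L%:R.
  elim: L => [|L IH] q.
    by rewrite expn0 ltnS leqn0 => /eqP ->; rewrite absv0.
  rewrite expnS mul2n => qL.
  have -> : q%:R = (odd q)%:R + 2%:R * q./2%:R :> F.
    by rewrite -natrM mul2n -natrD odd_double_half.
  apply: le_trans (absv_triangle _ _ _) _.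
  rewrite -[L.+1]add1n [leRHS]natrD absvM lerD //.
    by case: (odd q); rewrite ?absv0 ?absv1.
  have := IH q./2; rewrite -ltn_double (leq_ltn_trans _ qL) => [/(_ isT)|]; last first.
    by rewrite -[leqRHS]odd_double_half leq_addl.
  by apply: le_trans; rewrite ler_piMl // absv_ge0.
have mlt : (m < 2 ^ m)%N by exact: ltn_expl.
apply: (@expr_linear_le1 _ _ m%:R) => l l0.
rewrite -absvX -natrX -natrM; apply: digits.
by rewrite expnM ltn_exp2r.
Qed.

Lemma absv_le1_int : a 2%:R <= 1 -> forall m : int, a m%:~R <= 1.
Proof.
move=> a2 [m|m]; first exact: absv_le1_nat.
by rewrite NegzE intrN absvN; exact: (absv_le1_nat a2 m.+1).
Qed.

End Basics.

Section NumberField.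
Variables (k : fieldExtType rat) (a : absolute_value R k).
Local Notation OK := (@ring_of_integers k).

(** The powers of r are bounded, being integer combinations of finitely many of
them. *)
Lemma absv_integral_le1 r : a 2%:R <= 1 -> OK r -> a r <= 1.
Proof.
move=> a2 rO; have [D zE] := powers_span rO.
apply: (@expr_bounded_le1 _ _ (\sum_(i < D) a r ^+ i)) => l.
rewrite -absvX; have [z ->] := zE l; apply: le_trans (absv_sum_le _ _ _ _) _.
apply: ler_sum => i _; rewrite absvM absvX ler_piMl ?exprn_ge0 ?absv_ge0 //.
exact: absv_le1_int.
Qed.

(** Some nonzero integral element has absolute value below 1, and it divides a
positive integer. *)
Lemma absv_small_nat : absv_nontrivial a -> a 2%:R <= 1 ->
  exists2 m : nat, (0 < m)%N & a m%:R < 1.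
Proof.
move=> [x x0 ax1] a2.
suff [r [rO r0 ar]] : exists r, [/\ OK r, r != 0 & a r < 1].
  have [m m0 [s sO mE]] := integral_dvd_nat rO r0; exists m => //.
  rewrite mE absvM; apply: le_lt_trans ar.
  by rewrite ler_piMr ?absv_ge0 // absv_integral_le1.
have [d [dO d0 dxO]] := integral_denom x.
have lt1 r : OK r -> a r != 1 -> a r < 1.
  by move=> rO ar; rewrite lt_neqAle ar absv_integral_le1.
have [ad1|ad1] := eqVneq (a d) 1; last by exists d; split=> //; exact: lt1.
exists (d * x); split=> //; first exact: mulf_neq0.
by apply: lt1 => //; rewrite absvM ad1 mul1r.
Qed.

End NumberField.

Section Independence.
Variable F : fieldType.
Implicit Types a b : absolute_value R F.

Lemma open_valuedP a (U : set F) :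
  open (U : set (valued a)) <->
  forall x, U x -> exists2 e, 0 < e & forall y, a (y - x) < e -> U y.
Proof.
rewrite openE; split=> [oU x /oU /nbhs_ballP[e /= e0 eU]|h x /h [e e0 eU]].
  by exists e => // y yx; apply: eU; rewrite ballEmdist.
by apply/nbhs_ballP; exists e => //= y; rewrite ballEmdist => /eU.
Qed.

Lemma nontrivial_small a : absv_nontrivial a -> exists2 x, x != 0 & a x < 1.
Proof.
move=> [x x0]; rewrite neq_lt => /orP[ax|ax]; first by exists x.
by exists x^-1; rewrite ?invr_eq0 // absvV invf_lt1 ?absv_gt0.
Qed.

Lemma open_valued_le a b :
  absv_nontrivial a -> (forall z, a z < 1 -> b z < 1) ->
  forall U : set F, open (U : set (valued b)) -> open (U : set (valued a)).
Proof.
move=> /nontrivial_small[p p0 ap] ab U /open_valuedP oU; apply/open_valuedP.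
move=> x /oU[e e0 eU].
have [L _ /(_ L (leqnn L)) /= bpL] := expr_small (absv_ge0 b p) (ab _ ap) e0.
have pL0 : p ^+ L != 0 by rewrite expf_neq0.
exists (a (p ^+ L)) => [|y yx]; first exact: absv_gt0.
apply: eU; apply: lt_trans bpL; rewrite -absvX.
have := ab ((y - x) / p ^+ L); rewrite !absv_div !ltr_pdivrMr ?absv_gt0 // !mul1r.
exact.
Qed.

(** The hypothesis is in fact symmetric: if b z < 1 <= a z and p is small for a,
then p / z ^+ L is small for a but, for large L, not for b. Either implication
makes balls of one topology open in the other. *)
Lemma absv_lt1_equiv a b :
  absv_nontrivial a -> absv_nontrivial b ->
  (forall z, a z < 1 -> b z < 1) -> absv_equiv a b.
Proof.
move=> na nb ab.
have ba z : b z < 1 -> a z < 1.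
  move=> bz; rewrite ltNge; apply/negP => az.
  have [p p0 ap] := nontrivial_small na.
  have [L _ /(_ L (leqnn L)) /= bzL] := expr_small (absv_ge0 b z) bz (absv_gt0 b p0).
  have z0 : z != 0 by apply: contraTneq az => ->; rewrite absv0 -ltNge ltr01.
  have zL0 : z ^+ L != 0 by rewrite expf_neq0.
  have : b (p / z ^+ L) < 1.
    apply: ab; rewrite absv_div ltr_pdivrMr ?absv_gt0 // mul1r absvX.
    by apply: lt_le_trans ap _; rewrite exprn_ege1.
  by rewrite absv_div ltr_pdivrMr ?absv_gt0 // mul1r absvX ltNge (ltW bzL).
by move=> U; split; [exact: open_valued_le|exact: open_valued_le].
Qed.

Lemma absv_equiv_sym a b : absv_equiv a b -> absv_equiv b a.
Proof. by move=> ab U; split=> /ab. Qed.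

Lemma absv_equiv_trans a b c : absv_equiv a b -> absv_equiv b c -> absv_equiv a c.
Proof. by move=> ab bc U; split=> [/ab/bc|/bc/ab]. Qed.

Lemma absv_separate a b : absv_nontrivial a -> absv_nontrivial b ->
  ~ absv_equiv a b -> exists z, 1 < a z /\ b z < 1.
Proof.
move=> na nb nab.
have sep a' b' : absv_nontrivial a' -> absv_nontrivial b' ->
    ~ absv_equiv a' b' -> exists z, a' z < 1 /\ 1 <= b' z.
  move=> na' nb' h; apply: contrapT => none; apply: h.
  apply: absv_lt1_equiv => // z az; rewrite ltNge; apply/negP => bz.
  by apply: none; exists z.
have [z [az bz]] := sep _ _ na nb nab.
have [w [bw aw]] := sep _ _ nb na (fun h => nab (absv_equiv_sym h)).
have z0 : z != 0 by apply: contraTneq bz => ->; rewrite absv0 -ltNge ltr01.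
exists (w / z); rewrite !absv_div ltr_pdivlMr ?ltr_pdivrMr ?absv_gt0 // !mul1r.
by split; [exact: lt_le_trans aw|exact: lt_le_trans bz].
Qed.

(** The sequence z^l / (1 + z^l) tends to 1 where z is large and to 0 where z is
small. *)
Lemma absv_indicator_large a z e : 1 < a z -> 0 < e ->
  \forall l \near \oo, a (z ^+ l / (1 + z ^+ l) - 1) < e.
Proof.
move=> az e0; have := expr_unbounded (1 + e^-1) az; apply: filterS => l zl.
have := absv_lower a (z ^+ l) 1; rewrite absv1 absvX [_ + 1]addrC => lo.
have pos : e^-1 < a (1 + z ^+ l) by apply: lt_le_trans lo; lra.
have ei0 : 0 < e^-1 by rewrite invr_gt0.
have n0 : 1 + z ^+ l != 0 by apply: contraTneq pos => ->; rewrite absv0 -leNgt ltW.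
have -> : z ^+ l / (1 + z ^+ l) - 1 = - (1 + z ^+ l)^-1 by field.
by rewrite absvN absvV -[e]invrK ltf_pV2 ?posrE // (lt_trans ei0).
Qed.

Lemma absv_indicator_small a z e : a z < 1 -> 0 < e ->
  \forall l \near \oo, a (z ^+ l / (1 + z ^+ l)) < e.
Proof.
move=> az e0.
have h : 0 < e / (1 + e) by rewrite divr_gt0 //; lra.
have := expr_small (absv_ge0 a z) az h; apply: filterS => l.
rewrite ltr_pdivlMr => [zl|]; last by lra.
have := absv_lower a 1 (z ^+ l); rewrite absv1 absvX => lo.
have al0 : 0 <= a z ^+ l by rewrite exprn_ge0 ?absv_ge0.
have pos : 0 < a (1 + z ^+ l) by apply: lt_le_trans lo; nra.
by rewrite absv_div absvX ltr_pdivrMr //; nra.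
Qed.

Section WeakApproximation.
Variables (I : eqType) (b : I -> absolute_value R F).

(** Let y separate a from the new b i. If b i z = 1, the product z^l y works for
large l; if b i z > 1, then z^l is replaced by z^l / (1 + z^l), which tends to 1 at
a and at b i. *)
Lemma absv_separate_seq a (r : seq I) : absv_nontrivial a ->
  (forall i, i \in r -> absv_nontrivial (b i) /\ ~ absv_equiv a (b i)) ->
  exists2 z, 1 < a z & forall i, i \in r -> b i z < 1.
Proof.
move=> na; elim: r => [|i r IH] rP.
  have [x x0 ax] := nontrivial_small na.
  by exists x^-1 => //; rewrite absvV invf_gt1 ?absv_gt0.
have [j jr|z az bz] := IH; first by apply: rP; rewrite inE jr orbT.
have [ni nai] := rP _ (mem_head i r).
have [y [ay biy]] := absv_separate na ni nai.
have [biz|biz|biz] := ltgtP (b i z) 1.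
- by exists z => // j; rewrite inE => /orP[/eqP ->|/bz].
- have ya : 0 < 1 - (a y)^-1 by rewrite subr_gt0 invf_lt1 // (lt_trans _ ay).
  have yb : 0 < 1 - b i y by rewrite subr_gt0.
  have near_r : \forall l \near \oo, forall j, j \in r ->
      b j (z ^+ l / (1 + z ^+ l)) < (1 + b j y)^-1.
    apply: seq_near => j jr; apply: absv_indicator_small; first exact: bz.
    by rewrite invr_gt0 ltr_wpDr ?absv_ge0.
  near \oo => l.
  have aw : a (z ^+ l / (1 + z ^+ l) - 1) < 1 - (a y)^-1.
    by near: l; exact: absv_indicator_large.
  have bw : b i (z ^+ l / (1 + z ^+ l) - 1) < 1 - b i y.
    by near: l; exact: absv_indicator_large.
  have bjw j : j \in r -> b j (z ^+ l / (1 + z ^+ l)) < (1 + b j y)^-1.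
    by move: j; near: l.
  set w := z ^+ l / (1 + z ^+ l) in aw bw bjw *.
  exists (w * y) => [|j]; rewrite absvM.
    rewrite -ltr_pdivrMr ?(lt_trans _ ay) // mul1r.
    have := absv_lower a 1 (w - 1).
    by rewrite absv1 [1 + (w - 1)]addrC subrK; lra.
  rewrite inE => /orP[/eqP ->|jr].
    have := absv_triangle (b i) 1 (w - 1).
    rewrite absv1 [1 + (w - 1)]addrC subrK => wi.
    by have := absv_ge0 (b i) y; nra.
  have := bjw _ jr; have y0 := absv_ge0 (b j) y.
  by rewrite -[_^-1]mul1r ltr_pdivlMr ?ltr_wpDr //; have := absv_ge0 (b j) w; nra.
- have near_r : \forall l \near \oo, forall j, j \in r ->
      b j z ^+ l < (1 + b j y)^-1.
    apply: seq_near => j jr; apply: expr_small; [exact: absv_ge0|exact: bz|].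
    by rewrite invr_gt0 ltr_wpDr ?absv_ge0.
  near \oo => l.
  have bjw j : j \in r -> b j z ^+ l < (1 + b j y)^-1.
    by move: j; near: l.
  exists (z ^+ l * y) => [|j]; rewrite absvM absvX.
    apply: lt_le_trans ay _; rewrite ler_peMl ?absv_ge0 //.
    by rewrite exprn_ege1 // ltW.
  rewrite inE => /orP[/eqP ->|jr]; first by rewrite biz expr1n mul1r.
  have := bjw _ jr; have y0 := absv_ge0 (b j) y.
  rewrite -[_^-1]mul1r ltr_pdivlMr ?ltr_wpDr //.
  by have := exprn_ge0 l (absv_ge0 (b j) z); nra.
Unshelve. all: by end_near. Qed.

Lemma absv_indicator a (r : seq I) e : absv_nontrivial a ->
  (forall i, i \in r -> absv_nontrivial (b i) /\ ~ absv_equiv a (b i)) -> 0 < e ->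
  exists w, a (w - 1) < e /\ forall i, i \in r -> b i w < e.
Proof.
move=> na rP e0; have [z az bz] := absv_separate_seq na rP.
have near_r : \forall l \near \oo, forall j, j \in r ->
    b j (z ^+ l / (1 + z ^+ l)) < e.
  by apply: seq_near => j jr; apply: absv_indicator_small => //; exact: bz.
near \oo => l; exists (z ^+ l / (1 + z ^+ l)); split; near: l => //.
exact: absv_indicator_large.
Unshelve. all: by end_near. Qed.

(** The approximation is the sum of the t j * w j, where w j is close to 1 at j and
close to 0 at the other indices. *)
Lemma weak_approximation (r : seq I) (t : I -> F) (e : I -> R) :
  uniq r -> (forall i, i \in r -> absv_nontrivial (b i)) ->
  {in r &, forall i j, i != j -> ~ absv_equiv (b i) (b j)} ->
  (forall i, i \in r -> 0 < e i) ->
  exists x, forall i, i \in r -> b i (x - t i) < e i.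
Proof.
move=> ur nb bb e0; have [d d0 dP] := seq_lower_bound e0.
have [M M0 MP] := @seq_upper_bound R _ [seq (i, j) | i <- r, j <- r]
  (fun ij : I * I => b ij.1 (t ij.2)).
pose n := (size r).+1%:R : R.
have n0 : 0 < n by rewrite ltr0n.
have h0 : 0 < d / (n * M) by rewrite divr_gt0 // mulr_gt0.
have /choice[w wP] i : exists w, i \in r -> b i (w - 1) < d / (n * M) /\
    forall j, j \in r -> j != i -> b j w < d / (n * M).
  have [ir|_] := boolP (i \in r); last by exists 0.
  have [|//|w [w1 w2]] := @absv_indicator (b i) [seq j <- r | j != i]
    (d / (n * M)) (nb _ ir).
    move=> j; rewrite mem_filter => /andP[ji jr]; split; first exact: nb.
    by apply: bb => //; rewrite eq_sym.
  exists w => _; split=> // j jr ji; apply: w2.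
  by rewrite mem_filter ji.
exists (\sum_(j <- r) t j * w j) => i ir.
have -> : \sum_(j <- r) t j * w j - t i =
    \sum_(j <- r) t j * (w j - (j == i)%:R).
  rewrite (bigD1_seq i) // [RHS](bigD1_seq i) //= eqxx mulrBr mulr1 addrAC.
  by congr (_ + _); apply: eq_bigr => j /negPf ->; rewrite subr0.
apply: le_lt_trans (absv_sum_le _ _ _ _) _.
apply: lt_le_trans (dP _ ir).
apply: (@le_lt_trans _ _ (\sum_(j <- r) d / n)).
  rewrite big_seq [leRHS]big_seq; apply: ler_sum => j jr; rewrite absvM.
  have -> : d / n = M * (d / (n * M)).
    by rewrite [n * M]mulrC invfM mulrCA mulVKf ?gt_eqF.
  apply: ler_pM; rewrite ?absv_ge0 //.
    by apply: (MP (i, j)); apply/allpairsP; exists (i, j).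
  have [wj1 wj2] := wP _ jr; apply: ltW; have [->|ji] := eqVneq j i.
    by have [] := wP _ ir.
  by rewrite subr0; apply: wj2 => //; rewrite eq_sym.
rewrite big_const_seq count_predT iter_addr_0 -[_ *+ _]mulr_natr mulrAC ltr_pdivrMr //.
by rewrite ltr_pM2l // /n ltr_nat.
Qed.

End WeakApproximation.
End Independence.
End AbsoluteValues.

(** * Approximation of points of a linear subspace *)

Section Lines.
Variables (F : fieldType) (N : nat).

Lemma line_span (P : projective_space F N) x : x != 0 -> x \in P -> <[x]>%VS = P.
Proof.
move=> x0 xP; apply/eqP; rewrite eqEdim -memvE xP dim_vline x0.
by rewrite (eqP (dim_proj_line P)).
Qed.

Lemma line_unique (P Q : projective_space F N) x :
  x != 0 -> x \in P -> x \in Q -> P = Q.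
Proof.
move=> x0 xP xQ; apply/val_inj.
by rewrite /= -(line_span x0 xP) -(line_span x0 xQ).
Qed.

Lemma dim_span_line (x : 'rV[F]_N.+1) : x != 0 -> \dim <[x]>%VS == 1%N.
Proof. by rewrite dim_vline => ->. Qed.

Lemma exists_minor_neq0 (V : {vspace 'rV[F]_N.+1}) (x : 'rV[F]_N.+1) :
  (2 <= \dim V)%N -> x != 0 ->
  exists2 y, y \in V & exists i j, x 0 i * y 0 j - x 0 j * y 0 i != 0.
Proof.
move=> V2 x0; apply: contrapT => none.
have /rV0Pn[i xi0] := x0.
have /dimvS : (V <= <[x]>)%VS.
  apply/subvP => y yV; apply/vlineP; exists (y 0 i / x 0 i).
  apply/rowP => j; rewrite mxE; apply: (mulfI xi0).
  apply/eqP; rewrite mulrA mulrCA mulfV // mulr1 -subr_eq0.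
  apply/negP => h; apply: none; exists y => //; exists i, j.
  by rewrite [x 0 j * _]mulrC; apply/negP.
by rewrite dim_vline x0 leqNgt V2.
Qed.

End Lines.

Section LocalApproximation.
Variables (R : realType) (F K : fieldType) (iota : {rmorphism F -> K}).
Variables (a : absolute_value R K) (N : nat).

Lemma base_changeS (L V : {vspace 'rV[F]_N.+1}) :
  (L <= V)%VS -> (base_change iota L <= base_change iota V)%VS.
Proof.
move=> LV; apply/span_subvP => _ /mapP[y /vbasis_mem yL ->].
by apply: mem_base_change; exact: (subvP LV).
Qed.

Lemma projective_open_ball (W : set (projective_space K N)) P x :
  projective_open a W -> W P -> x != 0 -> x \in P ->
  exists2 e, 0 < e & forall w : 'rV[K]_N.+1,
    (forall i, a (w 0 i - x 0 i) < e) -> w != 0 /\ exists2 Q, W Q & w \in Q.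
Proof.
rewrite /projective_open openE => oW WP x0 xP.
have /oW /nbhs_ballP[e /= e0 eW] :
    [set y : 'rV[K]_N.+1 | y != 0 /\ exists2 P, W P & y \in P] x.
  by split=> //; exists P.
exists e => // w wx; apply: eW; split=> // i j.
by rewrite ord1 ballEmdist /=; exact: wx.
Qed.

(** A vector of the base change of V spanning a point of U has coordinates g j in
K on the basis of V; by density they are approximated by elements c j of F. The
vector x is then close to this vector, and x + (be / al) y is close to x. *)
Lemma local_approximation (V : {vspace 'rV[F]_N.+1})
    (U : set (projective_space K N)) :
  dense (range iota : set (valued a)) ->
  open_in_subspace a (base_change iota V) U -> U !=set0 ->
  exists (c : nat -> F) (e : R), 0 < e /\ forall d : nat -> F,
    (forall j, (j < \dim V)%N -> a (iota (d j - c j)) < e) ->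
    let x := \sum_(j < \dim V) d j *: (vbasis V)`_j in
    x != 0 /\ forall y, exists2 h, 0 < h &
      forall (al be : F) (P : projective_space F N),
        a (iota be) < h * a (iota al) ->
        al *: x + be *: y \in P -> (P <= V)%VS -> U (proj_map iota P).
Proof.
move=> iota_dense [W oW ->] [P0 [WP0 P0V]].
set m := \dim V; set b := fun j : nat => (vbasis V)`_j.
have x0 := hcoord_neq0 P0; set x_ := hcoord P0 in x0.
have xP0 : x_ \in P0 by exact: memv_pick.
have [e0 e0_gt0 eW] := projective_open_ball oW WP0 x0 xP0.
have [g gE] : exists g : nat -> K, x_ = \sum_(j < m) g j *: map_mx iota (b j).
  have /coord_span : x_ \in <<[tuple of [seq map_mx iota x | x <- vbasis V]]>>%VS.
    exact: subvP P0V _ xP0.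
  set cX := coord _ => xE.
  exists (fun j => if insub j is Some i then cX i x_ else 0).
  rewrite {1}xE; apply: eq_bigr => j _; rewrite valK; congr (_ *: _).
  by rewrite (nth_map 0) ?size_tuple.
pose E := 1 + \sum_(i < N.+1) \sum_(j < m) a (iota (b j 0 i)).
have sum_ge0 i : 0 <= \sum_(j < m) a (iota (b j 0 i)).
  by apply: sumr_ge0 => j _; exact: absv_ge0.
have E_gt0 : 0 < E.
  by rewrite ltr_pwDl ?ltr01 // sumr_ge0.
have leE i : \sum_(j < m) a (iota (b j 0 i)) <= E.
  rewrite /E (bigD1 i) //= addrCA lerDl addr_ge0 //.
  by apply: sumr_ge0 => j _; exact: sum_ge0.
have e_gt0 : 0 < e0 / (4 * E) by rewrite divr_gt0 // mulr_gt0.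
have /choice[c cP] j : exists c : F, a (iota c - g j) < e0 / (4 * E).
  have [||z [zB [c _ cz]]] := @iota_dense [set z | a (z - g j) < e0 / (4 * E)].
  - by exists (g j); rewrite /= subrr absv0.
  - apply/(open_valuedP a [set z | a (z - g j) < e0 / (4 * E)]) => z /= zg.
    exists (e0 / (4 * E) - a (z - g j)).
      by rewrite subr_gt0.
    move=> y yz; rewrite -[y - g j](subrKA z).
    by apply: le_lt_trans (absv_triangle _ _ _) _; rewrite -ltrBrDr.
  by exists c; rewrite cz.
exists c, (e0 / (4 * E)); split=> // d dP; set x := \sum_(j < m) _.
have xx i : a (iota (x 0 i) - x_ 0 i) <= e0 / 2.
  have -> : iota (x 0 i) - x_ 0 i =
      \sum_(j < m) (iota (d j) - g j) * iota (b j 0 i).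
    rewrite gE /x !summxE rmorph_sum -sumrB; apply: eq_bigr => j _.
    by rewrite !mxE rmorphM mulrBl.
  apply: le_trans (absv_sum_le _ _ _ _) _.
  apply: (@le_trans _ _ (\sum_(j < m) e0 / (2 * E) * a (iota (b j 0 i)))).
    apply: ler_sum => j _; rewrite absvM ler_wpM2r ?absv_ge0 //.
    have -> : iota (d j) - g j = iota (d j - c j) + (iota (c j) - g j).
      by rewrite rmorphB /= subrKA.
    apply: le_trans (absv_triangle _ _ _) _.
    have -> : e0 / (2 * E) = e0 / (4 * E) + e0 / (4 * E).
      by field; rewrite gt_eqF.
    by rewrite lerD // ltW // dP.
  rewrite -mulr_sumr; have -> : e0 / 2 = e0 / (2 * E) * E.
    by field; rewrite gt_eqF.
  by rewrite ler_wpM2l // ltW // divr_gt0 // mulr_gt0.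
have near_x (w : 'rV[F]_N.+1) : (forall i, a (iota (w 0 i - x 0 i)) < e0 / 2) ->
    w != 0 /\ exists2 Q, W Q & map_mx iota w \in Q.
  move=> wx; have [i|w0 QP] := eW (map_mx iota w).
    rewrite mxE; have -> : iota (w 0 i) - x_ 0 i =
        iota (w 0 i - x 0 i) + (iota (x 0 i) - x_ 0 i).
      by rewrite rmorphB /= subrKA.
    apply: le_lt_trans (absv_triangle _ _ _) _.
    by have := wx i; have := xx i; lra.
  by split=> //; rewrite -(map_mx_eq0 iota).
split; first by have [|] := near_x x => // i; rewrite subrr rmorph0 absv0; lra.
move=> y; have [M M0 MP] :=
  seq_upper_bound (enum 'I_N.+1) (fun i => a (iota (y 0 i))).
exists (e0 / (2 * M)); first by rewrite divr_gt0 // mulr_gt0.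
move=> al be P abe wP PV.
have al0 : al != 0.
  by apply: contraTneq abe => ->; rewrite rmorph0 absv0 mulr0 -leNgt absv_ge0.
have al_gt0 : 0 < a (iota al) by rewrite absv_gt0 // fmorph_eq0.
pose w := x + (be / al) *: y.
have {}wP : w \in P.
  have -> : w = al^-1 *: (al *: x + be *: y).
    by rewrite scalerDr !scalerA mulVf // scale1r mulrC.
  exact: memvZ.
have [i|w0 [Q WQ wQ]] := near_x w.
  have -> : w 0 i - x 0 i = be / al * y 0 i by rewrite /w !mxE addrAC subrr add0r.
  rewrite rmorphM absvM fmorph_div absv_div.
  have yM : a (iota (y 0 i)) <= M by apply: MP; rewrite mem_enum.
  rewrite mulrAC ltr_pdivrMr //; apply: (@le_lt_trans _ _ (a (iota be) * M)).
    by rewrite ler_wpM2l ?absv_ge0.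
  have -> : e0 / 2 * a (iota al) = e0 / (2 * M) * a (iota al) * M.
    by field; rewrite gt_eqF.
  by rewrite ltr_pM2r.
have wiP : map_mx iota w \in proj_map iota P by exact: mem_base_change.
split; last by apply: base_changeS.
by rewrite (line_unique (_ : map_mx iota w != 0) wiP wQ) ?map_mx_eq0.
Qed.

End LocalApproximation.

Section Places.
Variables (R : realType) (k : fieldExtType rat).

Lemma place_eq (v w : place R k) (a b : absolute_value R k) :
  place_of v a -> place_of w b -> absv_equiv a b -> v = w.
Proof.
move: v w => [[C [x CE]] vn] [[D [y DE]] wn]; rewrite /place_of /= => Ca Db ab.
have xa : absv_equiv x a by rewrite -CE.
have yb : absv_equiv y b by rewrite -DE.
apply: eq_exist; apply: eq_exist; rewrite CE DE; apply/seteqP; split=> z.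
  move=> xz; apply: absv_equiv_trans yb _.
  apply: absv_equiv_trans (absv_equiv_sym ab) _.
  exact: absv_equiv_trans (absv_equiv_sym xa) xz.
move=> yz; apply: absv_equiv_trans xa _; apply: absv_equiv_trans ab _.
exact: absv_equiv_trans (absv_equiv_sym yb) yz.
Qed.

Lemma place_nontrivial (v : place R k) (a : absolute_value R k) :
  place_of v a -> absv_nontrivial a.
Proof. exact: (svalP v a). Qed.

End Places.

(** * Weak approximation within an ideal class *)

Theorem theorem1p1 (R : realType) (k : fieldExtType rat)
    (kv : forall v : place R k, completion v)
    (N : nat) (hN : (1 <= N)%N)
    (V : {vspace 'rV[k]_N.+1}) (hV : (2 <= \dim V)%N)
    (c : class_group k)
    (S : set (place R k)) (hS : finite_set S)
    (U : forall v : place R k, set (projective_space (kv v) N))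
    (hUopen : forall v, S v ->
      open_in_subspace (compl_absv (kv v))
        (base_change (compl_emb (kv v)) V) (U v))
    (hUne : forall v, S v -> U v !=set0) :
  exists P : projective_space k N,
    [/\ linear_subspace V P,
        ideal_class_map P = c &
        forall v, S v -> U v (proj_map (compl_emb (kv v)) P)].
Proof.
pose a (v : {classic place R k}) :=
  absv_restrict (compl_emb (kv v)) (compl_absv (kv v)).
have aP v : place_of v (a v) := compl_place (kv v).
have an v : absv_nontrivial (a v) := place_nontrivial (aP v).
have [r ur SE] : exists2 r : seq {classic place R k},
    uniq r & forall v, S v <-> v \in r.
  have [r rE] := (@finite_seqP {classic place R k} S).1 hS.
  exists (undup r); first exact: undup_uniq.
  by move=> v; have -> := mem_undup r v; rewrite rE.
have [x [xV x0 xP]] : exists x, [/\ x \in V, x != 0 &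
    forall y v, exists2 h, 0 < h & v \in r ->
      forall (al be : k) (P : projective_space k N),
      a v be < h * a v al -> al *: x + be *: y \in P -> (P <= V)%VS ->
      U v (proj_map (compl_emb (kv v)) P)].
  have /choice[ce ceP] v : exists ce : (nat -> k) * R, v \in r -> 0 < ce.2 /\
      forall d : nat -> k,
      (forall j, (j < \dim V)%N -> a v (d j - ce.1 j) < ce.2) ->
      let x := \sum_(j < \dim V) d j *: (vbasis V)`_j in
      x != 0 /\ forall y, exists2 h, 0 < h &
        forall (al be : k) (P : projective_space k N), a v be < h * a v al ->
          al *: x + be *: y \in P -> (P <= V)%VS ->
          U v (proj_map (compl_emb (kv v)) P).
    have [/SE Sv|vr] := boolP (v \in r); last by exists (fun=> 0, 0).
    have [c0 [e [e0 cP]]] := local_approximation (@compl_dense _ _ _ (kv v))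
      (hUopen _ Sv) (hUne _ Sv).
    by exists (c0, e).
  have /choice[d dP] j : exists dj, forall v, v \in r ->
      a v (dj - (ce v).1 j) < (ce v).2.
    apply: (@weak_approximation R k _ a r (fun v => (ce v).1 j)
      (fun v => (ce v).2) ur) => [v _|v w vr wr|v /ceP[]] //.
    by move/eqP => vw vwa; apply: vw; exact: place_eq (aP v) (aP w) vwa.
  pose x := \sum_(j < \dim V) d j *: (vbasis V)`_j.
  have xV : x \in V.
    by apply: memv_suml => j _; apply/memvZ/vbasis_mem/mem_nth; rewrite size_tuple.
  (* Without any place x might vanish; every nonzero vector is then suitable. *)
  case: (r) SE ceP dP => [|v0 r'] SE' ceP dP.
    exists (vpick V); split; rewrite ?memv_pick // ?vpick0.
      by apply: contraTneq hV => ->; rewrite dimv0.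
    by move=> y v; exists 1.
  exists x; split=> //.
    have /ceP[_ /(_ d)[]] := mem_head v0 r'; last by [].
    by move=> j _; exact: dP (mem_head _ _).
  move=> y v; have [vr|_] := boolP (v \in v0 :: r'); last by exists 1.
  have [_ /(_ d)[j _|_ /(_ y)[h h0 hP]]] := ceP _ vr; first exact: dP.
  by exists h => // _.
clearbody a.
have [y yV [i0 [j0 xy]]] := exists_minor_neq0 hV x0.
have y0 : y != 0.
  by apply: contraNneq xy => ->; rewrite !mxE !mulr0 subrr.
have /choice[h hP] v : exists h, 0 < h /\ (v \in r ->
      forall (al be : k) (P : projective_space k N),
      a v be < h * a v al -> al *: x + be *: y \in P -> (P <= V)%VS ->
      U v (proj_map (compl_emb (kv v)) P)).
  by have [h] := xP y v; exists h.
have [e e0 eh] := @seq_lower_bound R _ r h (fun v _ => (hP v).1).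
have [dx [dxO dx0 dxx]] := frac_denom (coord_ideal x0).
have [dy [dyO dy0 dyy]] := frac_denom (coord_ideal y0).
(* D is a common denominator of all the coordinates of x and y. *)
pose D := dx * dy; have D0 : D != 0 by exact: mulf_neq0.
have XO i : ring_of_integers ((D *: x) 0 i).
  rewrite mxE /D mulrAC mulrC; apply: ring_of_integersM => //; apply: dxx.
  exact: coord_set_coord.
have YO i : ring_of_integers ((D *: y) 0 i).
  rewrite mxE /D -mulrA; apply: ring_of_integersM => //; apply: dyy.
  exact: coord_set_coord.
pose M := (D *: x) 0 i0 * (D *: y) 0 j0 - (D *: x) 0 j0 * (D *: y) 0 i0.
have M0 : M != 0.
  have -> : M = D ^+ 2 * (x 0 i0 * y 0 j0 - x 0 j0 * y 0 i0).
    by rewrite /M !mxE; ring.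
  by rewrite mulf_neq0 // expf_neq0.
have MO : ring_of_integers M.
  by apply: ring_of_integersB; exact: ring_of_integersM.
have [mM mM0 [s sO mME]] := integral_dvd_nat MO M0.
(* Q is small at the finite places of S, namely those with a v 2 <= 1. *)
have /choice[q qP] v : exists q : nat, (0 < q)%N /\ (a v 2%:R <= 1 -> a v q%:R < 1).
  have [a2|_] := boolP (a v 2%:R <= 1); last by exists 1%N.
  by have [q q0 q1] := absv_small_nat (an v) a2; exists q.
pose Q := (\prod_(v <- r) q v)%N.
have Q0 : (0 < Q)%N by rewrite prodn_gt0 // => v; have [] := qP v.
have Qsmall v : v \in r -> a v 2%:R <= 1 -> a v Q%:R < 1.
  move=> vr a2; rewrite /Q (bigD1_seq v) //= natrM absvM.
  apply: le_lt_trans ((qP v).2 a2); rewrite ler_piMr ?absv_ge0 //.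
  exact: absv_le1_nat.
have e20 : 0 < Num.min 2^-1 (e / 2) by rewrite lt_min invr_gt0 ltr0n divr_gt0.
have nearL : \forall L \near \oo, forall v, v \in r -> a v 2%:R <= 1 ->
    a v (mM * Q ^ L)%:R < Num.min 2^-1 (e / 2).
  apply: seq_near => v vr; have [a2|_] := boolP (a v 2%:R <= 1); last by near=> L.
  have := expr_small (absv_ge0 _ _) (Qsmall _ vr a2) e20; apply: filterS => L QL _.
  rewrite natrM natrX absvM absvX; apply: le_lt_trans QL.
  by rewrite ler_piMl ?exprn_ge0 ?absv_ge0 // absv_le1_nat.
have [L _ /(_ L (leqnn L)) /= nsmall] := nearL.
pose n : k := (mM * Q ^ L)%:R.
have n0 : n != 0 by apply: natr_neq0; rewrite muln_gt0 mM0 expn_gt0 Q0.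
have nO : ring_of_integers n by exact: ring_of_integers_nat.
have nE : n = s * (Q ^ L)%:R * M by rewrite /n natrM mME; ring.
have [C CE] : exists C, c = ideal_class C.
  by case: c => E [C EC]; exists C; exact: eq_exist.
have [|al [b [t [[tO alE bO] [l l0 pencil]]]]] :=
    @coord_ideal_pencil k _ (D *: x) (D *: y) i0 j0 n (s * (Q ^ L)%:R) C
      XO YO M0 _ nE n0.
  by apply: ring_of_integersM => //; exact: ring_of_integers_nat.
pose be := n * b.
have beO : ring_of_integers be by exact: ring_of_integersM.
pose w g := (al + g * be) *: (D *: x) + be *: (D *: y).
have w0 g : ring_of_integers g -> w g != 0.
  move=> gO; apply/eqP => wg0; have [z Cz z0] := frac_neq0 C.
  have : coord_set (w g) (l * z) by rewrite /w pencil //; exists z.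
  move=> [rr _]; rewrite wg0 big1 => [/eqP|i _]; last by rewrite mxE mulr0.
  by rewrite mulf_eq0 (negPf l0) (negPf z0).
(* At a finite place al + 2^g be is congruent to 1 modulo the small n, for every
   g; at an infinite place 2^g be eventually dominates. *)
have nearg : \forall g \near \oo, forall v, v \in r ->
    a v be < e * a v (al + (2 ^ g)%:R * be).
  apply: seq_near => v vr; have [a2|a2] := leP (a v 2%:R) 1.
    near=> g.
    have := nsmall _ vr a2; rewrite -/n lt_min => /andP[n1 n2].
    have bn : a v be <= a v n.
      by rewrite /be absvM ler_piMr ?absv_ge0 // absv_integral_le1.
    have : 1 - a v n <= a v (al + (2 ^ g)%:R * be).
      have -> : al + (2 ^ g)%:R * be = 1 + n * (t + (2 ^ g)%:R * b).
        by rewrite alE /be; ring.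
      apply: le_trans _ (absv_lower _ _ _); rewrite absv1 lerD2l lerN2 absvM.
      rewrite ler_piMr ?absv_ge0 // absv_integral_le1 //.
      apply: ring_of_integersD => //; apply: ring_of_integersM => //.
      exact: ring_of_integers_nat.
    set A := a v (_ + _) => lo.
    have : e * 2^-1 <= e * A by rewrite ler_pM2l //; lra.
    by lra.
  have [be0|be0] := eqVneq be 0.
    near=> g; rewrite be0 absv0 mulr0 addr0 mulr_gt0 // absv_gt0 //.
    have := w0 0 (@ring_of_integers0 k); rewrite /w be0 mul0r addr0 scale0r addr0.
    by rewrite scaler_eq0 => /norP[].
  have b0 : 0 < a v be by exact: absv_gt0.
  have := expr_unbounded (e^-1 + a v al / a v be) a2; apply: filterS => g.
  rewrite -(ltr_pM2r b0) mulrDl divfK ?gt_eqF // => lo.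
  have := absv_lower (a v) ((2 ^ g)%:R * be) al.
  rewrite absvM natrX absvX [_ + al]addrC => lo'.
  rewrite -ltr_pdivrMl //; lra.
have [g _ /(_ g (leqnn g)) /= gP] := nearg.
have gO : ring_of_integers ((2 ^ g)%:R : k) by exact: ring_of_integers_nat.
pose W := w (2 ^ g)%:R; have W0 : W != 0 by exact: w0.
pose P := ProjPoint (dim_span_line W0).
have WP : W \in P by exact: memv_line.
have PV : (P <= V)%VS.
  by rewrite -memvE /W /w memvD // !memvZ.
exists P; split=> //.
  rewrite (ideal_class_mapE W0 WP) CE; apply/ideal_classP/ideal_equiv_sym.
  by exists l => //; exact: (pencil _ gO).
move=> v /SE vr.
apply: ((hP v).2 vr ((al + (2 ^ g)%:R * be) * D) (be * D)) => //; last first.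
  by rewrite -!(scalerA _ D).
rewrite ![a v (_ * D)]absvM mulrA ltr_pM2r ?absv_gt0 //.
apply: lt_le_trans (gP _ vr) _; rewrite ler_wpM2r ?absv_ge0 //.
exact: eh.
Unshelve. all: by end_near. Qed.
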